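(* Let $N\ge1$ and $L\ge0$ be integers and let $\ell\in\{-NL,-NL+2,\dots,NL\}$. Then $$ T^{(N)}_0(L,\ell/2)=\sum_{i=0}^{\infty}q^{i(i+\ell)/N} \sum_{\substack{n\in\mathbb{Z}^{N-1}\\ \frac L2+\frac{2i+\ell}{2N}+(C^{-1}n)_1\in\mathbb{Z}}} q^{nC^{-1}n}\genfrac{[}{]}{0pt}{}{m+n}{n} \genfrac{[}{]}{0pt}{}{\frac12(L+\ell+m_1)}{i+\ell} \genfrac{[}{]}{0pt}{}{\frac12(L-\ell+m_1)}{i}, $$ where $m\in\mathbb{Z}^{N-1}$ is determined by $n$ and $i$ through $m+n=\frac12(\mathcal{I}m+(2i+\ell)e_1)$.
   Context: $(q)_k=\prod_{j=1}^k(1-q^j)$ for $k\ge0$, and $1/(q)_k=0$ for integers $k<0$. The $q$-binomial coefficient is $\genfrac{[}{]}{0pt}{}{a+b}{a}=\frac{(q)_{a+b}}{(q)_a(q)_b}$ if $a,b\ge0$ are integers and $0$ otherwise; in particular $\genfrac{[}{]}{0pt}{}{t}{k}=0$ unless $0\le k\le t$. $C$ is the Cartan matrix of $A_{N-1}$: $C_{ij}=2\delta_{i,j}-\delta_{|i-j|,1}$ for $i,j=1,\dots,N-1$; $\mathcal{I}=2I-C$; $e_1,\dots,e_{N-1}$ are the standard unit vectors of $\mathbb{Z}^{N-1}$; $nC^{-1}n=\sum_{i,j}n_iC^{-1}_{ij}n_j$; for vectors $\genfrac{[}{]}{0pt}{}{m+n}{n}=\prod_{j=1}^{N-1}\genfrac{[}{]}{0pt}{}{m_j+n_j}{n_j}$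 and $(q)_\eta=\prod_{j=1}^{N-1}(q)_{\eta_j}$. The $q$-multinomial coefficient $T^{(N)}_0(L,a)$, for an integer $L\ge0$ and $2a\in\{-NL,-NL+2,\dots,NL\}$, is $$ T^{(N)}_0(L,a)=\sum_{\substack{\eta\in\mathbb{Z}^{N-1}\\ \frac L2+\frac aN+(C^{-1}\eta)_1\in\mathbb{Z}}} \frac{q^{\eta C^{-1}\eta}\,(q)_L}{(q)_{\frac L2-\frac aN-(C^{-1}\eta)_1}\,(q)_{\frac L2+\frac aN-(C^{-1}\eta)_{N-1}}\,(q)_\eta}. $$ For $N=1$ the sums over $n$ and $\eta$ and the corresponding factors drop out, with $(C^{-1}\eta)_1=(C^{-1}\eta)_{N-1}=0$ and $m_1=0$. Fractional powers of $q$ are formal (or use a fixed consistent choice of roots). *)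

(* Defs.v *)
From HB Require Import structures.
From mathcomp Require Import all_boot all_order all_algebra.
From mathcomp Require Import zify ring lra.
From mathcomp Require Import boolp classical_sets functions cardinality fsbigop.

Set Implicit Arguments.
Unset Strict Implicit.
Unset Printing Implicit Defensive.

Import Order.TTheory GRing.Theory Num.Theory.
Local Open Scope classical_set_scope.
Local Open Scope ring_scope.

(* The rank is r = N - 1. All indices, exponents and arguments of q-factorials live in rat, so that
   half-integers and the entries of C^-1 need no casts. Columns are indexed
   from 0, so that component j of the text is component j - 1 here. *)

Section Cartan.
Variable r : nat.

Definition cartan : 'M[rat]_r :=
  \matrix_(i, j) (2 * (i == j)%:R - (`|i%:Z - j%:Z| == 1)%:R).

Definition incidence : 'M[rat]_r := 2%:M - cartan.

Definition e1 : 'cV[rat]_r := \col_j (j == 0 :> nat)%:R.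

Definition ratv (n : 'cV[int]_r) : 'cV[rat]_r := map_mx intr n.

(* k is counted from 0; out-of-range components are 0, which gives the
   convention v_1 = v_(N-1) = 0 when N = 1, i.e. r = 0. *)
Definition coordv (v : 'cV[rat]_r) (k : nat) : rat :=
  if insub k is Some j then v j 0 else 0.

Definition firstv (v : 'cV[rat]_r) : rat := coordv v 0.
Definition lastv (v : 'cV[rat]_r) : rat := coordv v r.-1.

Definition Cinvv (v : 'cV[rat]_r) : 'cV[rat]_r := invmx cartan *m v.

Definition Cform (v : 'cV[rat]_r) : rat := (v^T *m invmx cartan *m v) 0 0.

(* The solution m of m + n = (I m + k e_1) / 2; see mvecP below. *)
Definition mvec (k : int) (n : 'cV[int]_r) : 'cV[rat]_r :=
  Cinvv (k%:~R *: e1 - 2 *: ratv n).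

End Cartan.

Arguments e1 {r}.

Section QSeries.
Variable F : fieldType.
Implicit Types (q z : F) (x t k : rat).

(* (q)_k *)
Definition qpoch q (k : nat) : F := \prod_(1 <= j < k.+1) (1 - q ^+ j).

(* 1 / (q)_x, which is 0 for negative integers x; no non-integer x contributes
   to the sums below. *)
Definition qpoch_inv q x : F :=
  if x \is a Num.nat then (qpoch q (Num.truncn x))^-1 else 0.

(* [t; k], with t = a + b and k = a *)
Definition qbinom q t k : F :=
  if (k \is a Num.nat) && (t - k \is a Num.nat) then
    qpoch q (Num.truncn t) /
      (qpoch q (Num.truncn k) * qpoch q (Num.truncn (t - k)))
  else 0.

Definition qbinomv q r (t k : 'cV[rat]_r) : F :=
  \prod_j qbinom q (t j 0) (k j 0).

(* q^x for q = z^N and x in (1/N)Z; z is the chosen N-th root of q. N x is then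
   an integer and the floor only casts it to int. *)
Definition qpow (N : nat) z x : F := z ^ Num.floor (N%:R * x).

(* T_0^(N)(L, a), with q = z^N. As for every \sum_(_ \in _) below, this is a
   finite-support sum: see finite_qmultinomial. *)
Definition qmultinomial (N : nat) z (L : nat) (a : rat) : F :=
  let q := z ^+ N in
  \sum_(eta \in [set eta : 'cV[int]_N.-1 |
                 L%:R / 2 + a / N%:R + firstv (Cinvv (ratv eta)) \is a Num.int])
     qpow N z (Cform (ratv eta)) * qpoch q L
     * qpoch_inv q (L%:R / 2 - a / N%:R - firstv (Cinvv (ratv eta)))
     * qpoch_inv q (L%:R / 2 + a / N%:R - lastv (Cinvv (ratv eta)))
     * \prod_j qpoch_inv q (ratv eta j 0).

End QSeries.

(* The lemmas below check the definitions: C is invertible, m is integral and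
   is the unique solution of its defining equation, all exponents of q are in
   (1/N)Z, and all the sums have finite support. *)

Section CartanTheory.
Variable r : nat.
Implicit Types (v : 'cV[rat]_r) (n : 'cV[int]_r).

Definition cartan_inv : 'M[rat]_r :=
  \matrix_(i, j) ((minn i.+1 j.+1)%:R - (i.+1 * j.+1)%:R / r.+1%:R).

Lemma sum_pick (a : nat) (g : nat -> rat) :
  \sum_(k < r) (k == a :> nat)%:R * g k = if (a < r)%N then g a else 0.
Proof.
case: ltnP => ar.
  rewrite (bigD1 (Ordinal ar)) //= eqxx mul1r big1 ?addr0 // => k kN.
  by rewrite (_ : (k == a :> nat) = false) ?mul0r //; apply/negbTE.
rewrite big1 // => k _.
by rewrite (_ : (k == a :> nat) = false) ?mul0r //; have := ltn_ord k; lia.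
Qed.

Lemma cartan_invK : cartan r *m cartan_inv = 1%:M.
Proof.
apply/matrixP => i j; rewrite !mxE.
pose f (k : nat) : rat := (minn k j.+1)%:R - (k * j.+1)%:R / r.+1%:R.
have rN0 : (r.+1%:R : rat) != 0 by rewrite pnatr_eq0.
have f0 : f 0 = 0 by rewrite /f min0n mul0n mul0r subrr.
have fr : f r.+1 = 0.
  rewrite /f (minn_idPr _); last by have := ltn_ord j; lia.
  by rewrite natrM mulrAC divff // mul1r subrr.
have -> : \sum_k cartan r i k * cartan_inv k j =
    2 * (\sum_(k < r) (k == i :> nat)%:R * f k.+1)
    - (\sum_(k < r) (k == i.+1 :> nat)%:R * f k.+1)
    - (if (0 < i)%N then \sum_(k < r) (k == i.-1 :> nat)%:R * f k.+1 else 0).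
  rewrite (_ : (if _ then _ else _) =
     \sum_(k < r) ((0 < i)%N && (k == i.-1 :> nat))%:R * f k.+1); last first.
    case: ifP => //= _; rewrite big1 // => k _; by rewrite mul0r.
  rewrite mulr_sumr -!sumrB; apply: eq_bigr => k _; rewrite !mxE -/(f k.+1).
  rewrite mulrA -!mulrBl; congr (_ * _).
  rewrite (_ : (i == k) = (k == i :> nat)) 1?eq_sym // -addrA -opprD; congr (_ - _).
  rewrite -natrD; congr (_%:R).
  by have := ltn_ord i; have := ltn_ord k; lia.
rewrite !(sum_pick _ (fun k => f k.+1)) ltn_ord.
have -> : (if (i.+1 < r)%N then f i.+2 else 0) = f i.+2.
  case: ltnP => // h; have -> : i.+2 = r.+1 by have := ltn_ord i; lia.
  by rewrite fr.
have -> : (if (0 < i)%N then if (i.-1 < r)%N then f i.-1.+1 else 0 else 0) = f i.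
  case: (posnP i) => [->|i0]; first by rewrite f0.
  by rewrite prednK // ltnW ?ltn_ord.
rewrite /f.
have -> : 2 * ((minn i.+1 j.+1)%:R - (i.+1 * j.+1)%:R / r.+1%:R) -
    ((minn i.+2 j.+1)%:R - (i.+2 * j.+1)%:R / r.+1%:R) -
    ((minn i j.+1)%:R - (i * j.+1)%:R / r.+1%:R) =
    2 * (minn i.+1 j.+1)%:R - (minn i.+2 j.+1)%:R - (minn i j.+1)%:R :> rat.
  have E1 : i.+1%:R = i%:R + 1 :> rat by rewrite natr1.
  have E2 : i.+2%:R = i%:R + 2 :> rat by rewrite -natrD addn2.
  by rewrite !natrM E1 E2; ring.
have: (2 * minn i.+1 j.+1 = (i == j :> nat) + minn i.+2 j.+1 + minn i j.+1)%N by lia.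
move=> /(congr1 (GRing.natmul (1 : rat))); rewrite natrM !natrD => ->.
by rewrite -val_eqE /=; ring.
Qed.

Lemma cartan_unit : cartan r \in unitmx.
Proof. by have [] := mulmx1_unit cartan_invK. Qed.

Lemma invmx_cartan : invmx (cartan r) = cartan_inv.
Proof. by rewrite -[RHS](mulKmx cartan_unit) cartan_invK mulmx1. Qed.

Lemma mvecP (k : int) n (m : 'cV[rat]_r) :
  m + ratv n = 2^-1 *: (incidence r *m m + k%:~R *: e1) <-> m = mvec k n.
Proof.
have E : cartan r *m mvec k n = k%:~R *: e1 - 2 *: ratv n.
  by rewrite mulKVmx // cartan_unit.
rewrite /incidence mulmxBl mul_scalar_mx; split=> [h|->].
  rewrite /mvec /Cinvv -[LHS](mulKmx cartan_unit); congr (_ *m _).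
  move: h => /(congr1 (fun u => 2 *: u)); rewrite scalerA divff // scale1r.
  rewrite scalerDr => /eqP; rewrite -subr_eq0 => /eqP h.
  apply/eqP; rewrite -subr_eq0 -h; apply/eqP/matrixP => i j; rewrite !mxE; ring.
by rewrite E; apply/matrixP => i j; rewrite !mxE; field.
Qed.

End CartanTheory.

Section Integrality.
Variable r : nat.
Implicit Types (v : 'cV[rat]_r) (n : 'cV[int]_r).

Lemma firstvE v :
  firstv (Cinvv v) = \sum_(j < r) (r - j)%:R / r.+1%:R * v j 0.
Proof.
rewrite /firstv /coordv; case: insubP => [i _ i0|]; last first.
  rewrite -eqn0Ngt => /eqP r0; rewrite big1 // => j _; have := ltn_ord j; lia.
rewrite /Cinvv mxE invmx_cartan; apply: eq_bigr => j _; congr (_ * _).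
rewrite mxE i0 (minn_idPl _) // mul1n.
have rN0 : (r.+1%:R : rat) != 0 by rewrite pnatr_eq0.
rewrite -[X in X - _](divff rN0) -mulrBl; congr (_ / _).
by rewrite -natrB ?subSS // ltnW // ltnS.
Qed.

Lemma lastvE v :
  lastv (Cinvv v) = \sum_(j < r) j.+1%:R / r.+1%:R * v j 0.
Proof.
rewrite /lastv /coordv; case: insubP => [i ri i0|]; last first.
  move=> h; rewrite big1 // => j _; have := ltn_ord j; lia.
rewrite /Cinvv mxE invmx_cartan; apply: eq_bigr => j _; congr (_ * _).
rewrite mxE i0 prednK; last by have := ltn_ord j; lia.
rewrite (minn_idPr _); last exact: ltn_ord.
have rN0 : (r.+1%:R : rat) != 0 by rewrite pnatr_eq0.
rewrite -[X in X - _](mulfK rN0) -mulrBl; congr (_ / _).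
by rewrite -!natrM -natrB; [congr (_%:R); lia | lia].
Qed.

Lemma Cform_int n : r.+1%:R * Cform (ratv n) \is a Num.int.
Proof.
have rN0 : (r.+1%:R : rat) != 0 by rewrite pnatr_eq0.
rewrite /Cform mxE mulr_sumr rpred_sum // => j _; rewrite mulrA.
rewrite rpredM //; last by rewrite mxE intr_int.
rewrite mxE mulr_sumr rpred_sum // => k _.
rewrite mulrCA rpredM //; first by rewrite !mxE intr_int.
rewrite invmx_cartan mxE mulrBr mulrCA divff // mulr1.
by rewrite rpredB // ?rpredM // natr_int.
Qed.

Lemma mvecE (k : int) n (j : 'I_r) : mvec k n j 0 =
  k%:~R * (1 - j.+1%:R / r.+1%:R) -
  2 * (\sum_(i < r) (minn j.+1 i.+1)%:R * ratv n i 0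
       - j.+1%:R * lastv (Cinvv (ratv n))).
Proof.
rewrite lastvE /mvec /Cinvv invmx_cartan mulmxBr -!scalemxAr !mxE; congr (_ * _ - _ * _).
  have r0 : (0 < r)%N by have := ltn_ord j; lia.
  rewrite (bigD1 (Ordinal r0)) //= big1 ?addr0 ?mxE ?mulr1 ?muln1 ?(minn_idPr _) //.
  move=> i iN0; rewrite !mxE (_ : (i == 0 :> nat) = false) ?mulr0 //.
  by apply/negbTE; move: iN0; rewrite -val_eqE.
rewrite mulr_sumr -sumrB; apply: eq_bigr => i _.
by rewrite !mxE natrM; ring.
Qed.

Lemma lastv_firstv n :
  lastv (Cinvv (ratv n)) = \sum_i ratv n i 0 - firstv (Cinvv (ratv n)).
Proof.
rewrite lastvE firstvE -sumrB; apply: eq_bigr => j _.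
have rN0 : (r.+1%:R : rat) != 0 by rewrite pnatr_eq0.
have -> : (r - j)%:R = r.+1%:R - j.+1%:R :> rat.
  by rewrite -natrB ?subSS // ltnW // ltnS.
by rewrite mulrBl divff //; ring.
Qed.

Lemma mvec_int (L : nat) (k : int) n (j : 'I_r) :
    L%:R / 2 + k%:~R / (2 * r.+1%:R) + firstv (Cinvv (ratv n)) \is a Num.int ->
  mvec k n j 0 \is a Num.int.
Proof.
have rN0 : (r.+1%:R : rat) != 0 by rewrite pnatr_eq0.
have aux (N J l K T T' u : rat) : N != 0 ->
    K * (1 - J / N) - 2 * (T - J * (T' - u)) =
    K - 2 * T + 2 * J * T' + J * l - J * (2 * (l / 2 + K / (2 * N) + u)).
  by move=> N0; field.
move=> h; rewrite mvecE lastv_firstv.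
set S := \sum_i _; set S' := \sum_i _ in h *; set c := firstv _ in h *.
have -> : k%:~R * (1 - j.+1%:R / r.+1%:R) - 2 * (S - j.+1%:R * (S' - c)) =
   k%:~R - 2 * S + 2 * j.+1%:R * S' + j.+1%:R * L%:R
   - j.+1%:R * (2 * (L%:R / 2 + k%:~R / (2 * r.+1%:R) + c)) :> rat.
  exact: aux.
have hS : S \is a Num.int.
  by rewrite rpred_sum // => i _; rewrite mxE rpredM ?intr_int ?natr_int.
have hS' : S' \is a Num.int by rewrite rpred_sum // => i _; rewrite mxE intr_int.
rewrite rpredB // ?rpredM ?natr_int // rpredD ?rpredM ?natr_int //.
by rewrite rpredD ?rpredM ?natr_int // rpredB ?intr_int ?rpredM ?natr_int.
Qed.

End Integrality.

Lemma firstv_mvec r (k : int) (n : 'cV[int]_r) :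
  firstv (mvec k n) = (if r is 0 then 0 else k%:~R * (1 - r.+1%:R^-1)) -
    2 * firstv (Cinvv (ratv n)).
Proof.
case: r n => [|s] n.
  have e (v : 'cV[rat]_0) : firstv v = 0 by rewrite /firstv /coordv insubF.
  by rewrite !e mulr0 subr0.
have e (v : 'cV[rat]_s.+1) : firstv v = v ord0 0.
  rewrite /firstv /coordv; case: insubP => // i _ i0; congr (v _ _).
  exact: val_inj.
rewrite (e (mvec k n)) mvecE e /= div1r mul1r; congr (_ - 2 * _).
have -> : lastv (Cinvv (ratv n)) = \sum_i ratv n i 0 - Cinvv (ratv n) ord0 0.
  by rewrite -e lastv_firstv.
rewrite opprB addrCA (_ : \sum_i _ = \sum_i ratv n i 0) ?subrr ?addr0 //.
by apply: eq_bigr => i _; rewrite (minn_idPl _) // mul1r.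
Qed.

Section Finiteness.
Variable F : fieldType.
Implicit Types (q z : F).

Lemma qpoch_inv_nat q (x : rat) : qpoch_inv q x != 0 -> x \is a Num.nat.
Proof. by rewrite /qpoch_inv; case: ifP => //; rewrite eqxx. Qed.

Lemma qbinom_nat q (t k : rat) : qbinom q t k != 0 ->
  (k \is a Num.nat) && (t - k \is a Num.nat).
Proof. by rewrite /qbinom; case: ifP => //; rewrite eqxx. Qed.

Lemma finite_box r (B : rat) (A : set 'cV[int]_r) :
  (forall n, A n -> (forall j, 0 <= n j 0) /\ firstv (Cinvv (ratv n)) <= B) ->
  finite_set A.
Proof.
move=> hA; pose K := (Num.truncn (r.+1%:R * B)).+1.
apply: (@sub_finite_set _ _
  ((fun f : {ffun 'I_r -> 'I_K} => \col_j (f j : nat)%:Z : 'cV[int]_r) @` setT));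
  last by apply: finite_image; exact: finite_finset.
move=> n /hA [n0 hB].
have bd j : (`|n j 0%R| < K)%N.
  have h : (n j 0)%:~R <= r.+1%:R * B :> rat.
    rewrite mulrC -ler_pdivrMr ?ltr0n //; apply: le_trans hB.
    rewrite firstvE (bigD1 j) //= ler_wpDr //.
      apply: sumr_ge0 => i _; rewrite !mulr_ge0 ?invr_ge0 ?ler0n //.
      by rewrite mxE ler0z.
    rewrite mxE mulrAC ler_wpM2r ?invr_ge0 ?ler0n // ler_peMl ?ler0z //.
    by rewrite ler1n subn_gt0.
  rewrite -(ltr_nat rat); apply: le_lt_trans (truncnS_gt _).
  by rewrite natr_absz ger0_norm.
exists [ffun j => Ordinal (bd j)] => //.
by apply/matrixP => j i; rewrite !mxE ffunE /= ord1 gez0_abs.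
Qed.

Lemma finite_qmultinomial N z (L : nat) (a : rat) : (0 < N)%N ->
  let q := z ^+ N in
  finite_set [set eta : 'cV[int]_N.-1 |
     qpow N z (Cform (ratv eta)) * qpoch q L
     * qpoch_inv q (L%:R / 2 - a / N%:R - firstv (Cinvv (ratv eta)))
     * qpoch_inv q (L%:R / 2 + a / N%:R - lastv (Cinvv (ratv eta)))
     * \prod_j qpoch_inv q (ratv eta j 0) != 0].
Proof.
case: N => // r _ q; apply: (@finite_box _ (L%:R / 2 - a / r.+1%:R)) => n /=.
rewrite !mulf_eq0 !negb_or -!andbA => /and5P[_ _ /qpoch_inv_nat h _ /prodf_neq0 hp].
split; last by rewrite -subr_ge0 natr_ge0.
by move=> j; have /qpoch_inv_nat/natr_ge0 := hp j isT; rewrite mxE ler0z.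
Qed.

(* The product of q-binomials in the (i, n) term of the fermionic sum. *)
Definition binom_term N q (L : nat) (l : int) (i : nat) (n : 'cV[int]_N.-1) : F :=
  let m := mvec (2 * i%:Z + l) n in
  qbinomv q (m + ratv n) (ratv n)
    * qbinom q ((L%:R + l%:~R + firstv m) / 2) (i%:R + l%:~R)
    * qbinom q ((L%:R - l%:~R + firstv m) / 2) i%:R.

Lemma binom_term_bound N q L l i (n : 'cV[int]_N.-1) : (0 < N)%N ->
  binom_term q L l i n != 0 ->
  (forall j, 0 <= n j 0) /\
  (2 * i%:R + l%:~R) / N%:R + 2 * firstv (Cinvv (ratv n)) <= L%:R.
Proof.
case: N n => // r n _; rewrite /binom_term /= !mulf_eq0 !negb_or -andbA.
case/and3P=> /prodf_neq0 hp /qbinom_nat/andP[_ /natr_ge0 h1] /qbinom_nat/andP[_ /natr_ge0 h2].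
split=> [j|].
  by have /qbinom_nat/andP[/natr_ge0 + _] := hp j isT; rewrite mxE ler0z.
have := addr_ge0 h1 h2; rewrite firstv_mvec; set c := firstv _.
have -> : (2 * i%:Z + l)%:~R = 2 * i%:R + l%:~R :> rat by rewrite intrD intrM.
have aux (x y I j u : rat) : 0 <= (x + j + (y - 2 * u)) / 2 - (I + j) +
    ((x - j + (y - 2 * u)) / 2 - I) -> 2 * I + j - y + 2 * u <= x by lra.
move/aux; apply: le_trans; rewrite lerD2r.
case: (r) => [|s]; first by rewrite divr1 subr0.
by rewrite mulrBr mulr1 subKr.
Qed.

(* For fixed i the sum over n is finite, and only finitely many i contribute. *)
Lemma finite_sum_n N z L l i : (0 < N)%N ->
  finite_set [set n : 'cV[int]_N.-1 | binom_term (z ^+ N) L l i n != 0].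
Proof.
move=> N0; apply: (@finite_box _ ((L%:R - (2 * i%:R + l%:~R) / N%:R) / 2)) => n.
by case/(binom_term_bound N0) => h1 h2; split => //; lra.
Qed.

Lemma finite_sum_i N z L l : (0 < N)%N ->
  finite_set [set i : nat |
    exists n : 'cV[int]_N.-1, binom_term (z ^+ N) L l i n != 0].
Proof.
move=> N0; apply: (@sub_finite_set _ _ `I_(N * L + `|l|).+1); last exact: finite_II.
move=> i [n] /(binom_term_bound N0) [n0 h] /=.
have c0 : 0 <= firstv (Cinvv (ratv n)).
  rewrite firstvE sumr_ge0 // => j _; rewrite !mulr_ge0 ?invr_ge0 ?ler0n //.
  by rewrite mxE ler0z.
have : (2 * i%:R + l%:~R) / N%:R <= L%:R :> rat by lra.
rewrite ler_pdivrMr ?ltr0n //.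
have -> : 2 * i%:R + l%:~R = (2 * i%:Z + l)%:~R :> rat by rewrite intrD intrM.
have -> : L%:R * N%:R = (N * L)%:Z%:~R :> rat by rewrite -natrM mulnC.
by rewrite ler_int; lia.
Qed.

End Finiteness.

(* Main.v *)
Require Import Defs.
From HB Require Import structures.
From mathcomp Require Import all_boot all_order all_algebra.
From mathcomp Require Import zify ring.
From mathcomp Require Import boolp classical_sets fsbigop.

Set Implicit Arguments.
Unset Strict Implicit.
Unset Printing Implicit Defensive.

Import Order.TTheory GRing.Theory Num.Theory.
Local Open Scope classical_set_scope.
Local Open Scope ring_scope.

(** Put s = (N L + l) / 2, and write n_k = j_k - j_(k+1), and likewise eta_k,
    in terms of integers j_1, ..., j_N with sum S. Then (C^-1 n)_1 = j_1 - S/N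
    and n C^-1 n = sum_k j_k^2 - S^2/N, so that the integrality conditions say
    that S = s on the left-hand side and S = s + i on the right-hand side; in
    the latter case m_k = sum_(t > k) (2 j_t - L). All nonzero terms have
    L >= j_1 >= ... >= j_N >= 0. On both sides the power of q is
    q^(L s - s^2/N) times the product of the q^(j_k (j_k - L)). Up to this
    common factor, the left-hand side is A_N(L, l), where
    [A_N(h, beta) = sum_j q^(j(j-L)) [h;j] A_(N-1)(j, beta + L - 2j)],
    [h;j] is a q-binomial, and A_0(h, beta) is 1 if beta = 0 and 0 otherwise
    (lemmas [qmultinomialE] and [multinomial_chainE]). On the right-hand side
    the q-binomials [m_k + n_k; m_k] form a chain of the same kind, to which the
    two q-binomials with bottoms i + l and i are attached (lemmas
    [fermionic_sumE] and [fermionic_chainE]).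

    The equality of the two chains holds more generally, with [h;j] for h <= L
    in place of [L;j] and with any integer beta in place of l; this allows an
    induction on N (lemma [fermionic_sum_multinomial]). With j_2 and m_1 fixed,
    the sum over j_1 on the right-hand side contains three q-binomials. The
    transformation [gbin_double_sum], which follows from repeated use of the
    q-Vandermonde sum, rewrites it as a sum over a new index j, in which
    [h;j] q^(j(j-L)) times the two attached q-binomials for N - 1, j and
    beta + L - 2j appear: this is the recursion of A_N. For N = 1 the
    theorem is the q-Vandermonde sum itself.

    The intermediate beta can be negative even if l is not. The transformation
    is therefore stated for q-binomials whose top is an arbitrary integer. *)

(** * Shifting sums over integers *)

Section IntSums.
Variable V : nmodType.

(** Both sides are the sum of f over all integers. *)
Lemma sum_int_shift (f : int -> V) (a b : nat) (s : int) :
  (forall z, f z != 0 -> (0 <= z < a%:Z) && (0 <= z - s < b%:Z)) ->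
  \sum_(i < a) f i%:Z = \sum_(j < b) f (j%:Z + s).
Proof.
have full (n : nat) (s' : int) (g : int -> V) :
    (forall z, g z != 0 -> 0 <= z - s' < n%:Z) ->
  \sum_(z \in [set: int]) g z = \sum_(i < n) g (i%:Z + s').
  move=> supp; pose r := [seq i%:Z + s' | i <- iota 0 n].
  rewrite (@fsbigE _ _ _ _ _ r) //; last 2 first.
  - by rewrite map_inj_uniq ?iota_uniq // => i j; lia.
  - move=> z _; apply: contraNeq => /supp h; apply/mapP; exists `|z - s'|%N; last lia.
    by rewrite mem_iota; lia.
  rewrite big_map -(big_mkord xpredT (fun i : nat => g (i%:Z + s'))) /index_iota subn0.
  by apply: eq_bigl => i; rewrite in_setT.
move=> supp; rewrite -(full b s f) => [|z /supp/andP[]//].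
rewrite (full a 0 f) => [|z /supp/andP[]]; last by rewrite subr0.
by apply: eq_bigr => i _; rewrite addr0.
Qed.

End IntSums.

(** * Gaussian binomials with an integer top *)

Definition qfall (F : fieldType) (q : F) (t : int) (n : nat) : F :=
  \prod_(a < n) (1 - q ^ (t - a%:Z)).

(** For t < 0 <= k the value is in general not 0, unlike that of [qbinom]: this
    is the convention under which identities that are polynomial in q^t hold for
    all integers t. The definition is locked because conversion would otherwise
    expose a quotient to the rules about products being zero. *)
HB.lock Definition gbin (F : fieldType) (q : F) (t k : int) : F :=
  if k is Posz n then qfall q t n / qpoch q n else 0.

Section GaussianBinomials.
Variables (F : fieldType) (q : F).
Hypothesis q_nroot : forall k : nat, (0 < k)%N -> q ^+ k != 1.
Local Notation qfall := (qfall q).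
Local Notation gbin := (gbin q).

Lemma qpochS n : qpoch q n.+1 = qpoch q n * (1 - q ^+ n.+1).
Proof. by rewrite /qpoch big_nat_recr. Qed.

Lemma qpoch0 : qpoch q 0 = 1. Proof. by rewrite /qpoch big_geq. Qed.

Lemma subX_neq0 n : 1 - q ^+ n.+1 != 0.
Proof. by rewrite subr_eq0 eq_sym q_nroot. Qed.

Lemma qpoch_neq0 n : qpoch q n != 0.
Proof. by elim: n => [|n IH]; rewrite ?qpoch0 ?oner_neq0 // qpochS mulf_neq0 ?subX_neq0. Qed.

Lemma qfallS t n : qfall t n.+1 = qfall t n * (1 - q ^ (t - n%:Z)).
Proof. by rewrite /qfall big_ord_recr. Qed.

Lemma qfall_add t m n : qfall t (m + n) = qfall t m * qfall (t - m%:Z) n.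
Proof.
elim: n => [|n IH]; first by rewrite addn0 /qfall big_ord0 mulr1.
rewrite addnS !qfallS IH -mulrA; do 2!congr (_ * _); congr (_ - q ^ _); lia.
Qed.

Lemma qfallSl t n : qfall (t + 1) n.+1 = (1 - q ^ (t + 1)) * qfall t n.
Proof.
rewrite -[n.+1]/(1 + n)%N qfall_add /qfall big_ord1 subr0; congr (_ * _).
by apply: eq_bigr => i _; congr (1 - q ^ _); ring.
Qed.

Lemma qfall_nat m n : qfall (m + n)%:Z n * qpoch q m = qpoch q (m + n).
Proof.
elim: n => [|n IH]; first by rewrite addn0 /qfall big_ord0 mul1r.
rewrite addnS qpochS -IH exprnP.
have -> : (m + n).+1%:Z = (m + n)%:Z + 1 :> int by lia.
by rewrite qfallSl; ring.
Qed.

Lemma gbin_lt0 t k : k < 0 -> gbin t k = 0.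
Proof. by rewrite gbin.unlock; case: k. Qed.

Lemma gbin0 t : gbin t 0 = 1.
Proof. by rewrite gbin.unlock /= /qfall big_ord0 qpoch0 divr1. Qed.

Lemma gbin_small t k : 0 <= t -> t < k -> gbin t k = 0.
Proof.
case: k => // n; case: t => // m _ mn; rewrite gbin.unlock /qfall.
by rewrite (bigD1 (Ordinal (mn : (m < n)%N))) //= subrr expr0z subrr !mul0r.
Qed.

Lemma gbin_neq0 t k : gbin t k != 0 -> 0 <= k /\ (0 <= t -> k <= t).
Proof.
move=> h; split; first by apply: contraNT h; rewrite -ltNge => /gbin_lt0 ->.
by move=> t0; apply: contraNT h; rewrite -ltNge => /(gbin_small t0) ->.
Qed.

Lemma gbin_nat m n :
  gbin (m + n)%:Z m%:Z = qpoch q (m + n) / (qpoch q m * qpoch q n).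
Proof.
by rewrite gbin.unlock addnC -(qfall_nat n m); field; rewrite !qpoch_neq0.
Qed.

Lemma gbin_sym (n : nat) (k : int) : gbin n%:Z k = gbin n%:Z (n%:Z - k).
Proof.
case: k => k; last by rewrite [LHS]gbin_lt0 // gbin_small //; lia.
case: (leqP k n) => kn; last by rewrite [LHS]gbin_small // gbin_lt0 //; lia.
rewrite -(subnKC kn) gbin_nat (_ : (k + (n - k))%:Z - k%:Z = (n - k)%:Z); last lia.
by rewrite addnC gbin_nat addnC (mulrC (qpoch q k)).
Qed.

Lemma gbinSl t n : gbin (t + 1) n.+1%:Z = gbin t n%:Z * ((1 - q ^ (t + 1)) / (1 - q ^+ n.+1)).
Proof.
by rewrite gbin.unlock qfallSl qpochS; field; rewrite qpoch_neq0 subX_neq0.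
Qed.

Lemma gbinSr t n : gbin t n.+1%:Z = gbin t n%:Z * ((1 - q ^ (t - n%:Z)) / (1 - q ^+ n.+1)).
Proof.
by rewrite gbin.unlock qfallS qpochS; field; rewrite qpoch_neq0 subX_neq0.
Qed.

Hypothesis q_neq0 : q != 0.

Lemma gbin_pascal t k : gbin (t + 1) k = gbin t (k - 1) + q ^ k * gbin t k.
Proof.
case: k => [[|n]|n].
- by rewrite !gbin0 gbin_lt0 // add0r expr0z mul1r.
- rewrite gbinSl gbinSr (_ : n.+1%:Z - 1 = n%:Z); last lia.
  have -> : q ^ (t + 1) = q ^+ n.+1 * q ^ (t - n%:Z).
    by rewrite exprnP -expfzDr //; congr (q ^ _); lia.
  by rewrite -exprnP; field; exact: subX_neq0.
- by rewrite !gbin_lt0 // mulr0 addr0.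
Qed.

Lemma gbin_pascal2 t k : gbin (t + 1) k = q ^ (t + 1 - k) * gbin t (k - 1) + gbin t k.
Proof.
case: k => [[|n]|n].
- by rewrite !gbin0 gbin_lt0 // mulr0 add0r.
- rewrite gbinSl gbinSr (_ : n.+1%:Z - 1 = n%:Z); last lia.
  rewrite (_ : t + 1 - n.+1%:Z = t - n%:Z); last lia.
  have -> : q ^ (t + 1) = q ^+ n.+1 * q ^ (t - n%:Z).
    by rewrite exprnP -expfzDr //; congr (q ^ _); lia.
  by field; exact: subX_neq0.
- by rewrite !gbin_lt0 // mulr0 addr0.
Qed.

(** For p, r >= 0 both sides are the falling product [qfall] of d of length
    p + r, divided by (q)_p (q)_r. *)
Lemma gbin_trinomial d p r :
  gbin d p * gbin (d - p) r = gbin d (p + r) * gbin (p + r) r.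
Proof.
case: r => r; last by rewrite ![gbin _ (Negz r)]gbin_lt0 // !mulr0.
case: p => p; last first.
  rewrite [gbin _ (Negz p)]gbin_lt0 // mul0r; case: (ltP (Negz p + r%:Z) 0) => h.
    by rewrite [gbin d _]gbin_lt0 // mul0r.
  by rewrite (gbin_small h) ?mulr0 //; lia.
rewrite -!PoszD; rewrite gbin.unlock qfall_add -(qfall_nat p r).
have := qpoch_neq0 (p + r); rewrite -(qfall_nat p r) mulf_eq0 negb_or => /andP[h1 h2].
by field; rewrite h1 h2 qpoch_neq0.
Qed.

(** Induction on a: one unit of the top is moved from a + 1 to b, where the two
    Pascal rules match the terms. *)
Lemma gbin_vandermonde (a : nat) (b n : int) :
  gbin (a%:Z + b) n =
  \sum_(k < a.+1) q ^ ((a%:Z - k%:Z) * (n - k%:Z)) * gbin a%:Z k%:Z * gbin b (n - k%:Z).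
Proof.
elim: a b => [|a IH] b.
  by rewrite big_ord1 add0r !subr0 mul0r expr0z gbin0 !mul1r.
have -> : a.+1%:Z + b = a%:Z + (b + 1) by lia.
rewrite IH; pose G (k : int) := q ^ ((a.+1%:Z - k) * (n - k)) * gbin b (n - k).
transitivity (\sum_(k < a.+1) gbin a%:Z k%:Z * G k%:Z +
   \sum_(k < a.+1) q ^ (a%:Z - k%:Z) * gbin a%:Z k%:Z * G k.+1%:Z).
  rewrite -big_split; apply: eq_bigr => k _ /=; rewrite gbin_pascal /G.
  have -> : n - k%:Z - 1 = n - k.+1%:Z by lia.
  have -> : (a.+1%:Z - k%:Z) * (n - k%:Z) = (a%:Z - k%:Z) * (n - k%:Z) + (n - k%:Z).
    by rewrite intS; ring.
  have -> : (a%:Z - k%:Z) * (n - k%:Z) =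
      (a%:Z - k%:Z) + (a.+1%:Z - k.+1%:Z) * (n - k.+1%:Z).
    by rewrite !intS; ring.
  by rewrite !expfzDr //; ring.
have -> : \sum_(k < a.+1) gbin a%:Z k%:Z * G k%:Z =
    \sum_(k < a.+2) gbin a%:Z k%:Z * G k%:Z.
  by rewrite [RHS]big_ord_recr /= gbin_small ?mul0r ?addr0 //; lia.
have -> : \sum_(k < a.+1) q ^ (a%:Z - k%:Z) * gbin a%:Z k%:Z * G k.+1%:Z =
    \sum_(k < a.+2) q ^ (a.+1%:Z - k%:Z) * gbin a%:Z (k%:Z - 1) * G k%:Z.
  rewrite [RHS]big_ord_recl /= [gbin _ (0 - 1)]gbin_lt0 // mulr0 mul0r add0r.
  apply: eq_bigr => k _; rewrite /bump /= add1n.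
  by congr (q ^ _ * gbin _ _ * _); lia.
rewrite -big_split; apply: eq_bigr => k _ /=.
have -> : a.+1%:Z = a%:Z + 1 :> int by lia.
rewrite gbin_pascal2 /G (_ : a.+1%:Z = a%:Z + 1) //; [ring|lia].
Qed.

(** The q-Vandermonde sum with n = a + s, read from k = a downwards. *)
Lemma gbin_vandermonde_shift (a : nat) (b s : int) :
  \sum_(t < a.+1) q ^ (t%:Z * (t%:Z + s)) * gbin b (t%:Z + s) * gbin a%:Z t%:Z =
  gbin (a%:Z + b) (a%:Z + s).
Proof.
rewrite gbin_vandermonde (reindex_inj rev_ord_inj); apply: eq_bigr => /= t _.
have -> : (a.+1 - t.+1)%N%:Z = a%:Z - t%:Z by have := ltn_ord t; lia.
rewrite mulrAC [in RHS]gbin_sym; congr (q ^ _ * gbin _ _ * gbin _ _); lia.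
Qed.

Lemma gbin_vandermonde_offset (c : int) (a n : nat) (b s : int) :
    a%:Z + c < n%:Z -> 0 <= c ->
  \sum_(z < n) q ^ ((z%:Z - c) * (z%:Z - c + s)) *
     gbin b (z%:Z - c + s) * gbin a%:Z (z%:Z - c) =
  gbin (a%:Z + b) (a%:Z + s).
Proof.
move=> an c0; rewrite -gbin_vandermonde_shift.
pose f z := q ^ ((z - c) * (z - c + s)) * gbin b (z - c + s) * gbin a%:Z (z - c).
rewrite (@sum_int_shift _ f n a.+1 c); last first.
  move=> z; rewrite /f mulf_eq0 negb_or => /andP[_ /gbin_neq0[h1 h2]].
  by have := h2 isT; lia.
by apply: eq_bigr => t _; rewrite /f addrK.
Qed.

(** Expanding [i+d;x] by q-Vandermonde makes the sum over i a q-Vandermonde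
    sum again, with B lowered by the new summation index. *)
Lemma gbin_triple_product_left (A beta d : int) (B x : nat) :
  \sum_(i < B.+1) q ^ (i%:Z * (i%:Z + beta - x%:Z)) *
     gbin A (i%:Z + beta) * gbin B%:Z i%:Z * gbin (i%:Z + d) x%:Z =
  \sum_(u < B.+1) q ^ (u%:Z * (u%:Z + beta - x%:Z)) * gbin B%:Z u%:Z *
    gbin d (x%:Z - u%:Z) * gbin (A + B%:Z - u%:Z) (B%:Z + beta).
Proof.
pose G (i u : nat) :=
   (q ^ (u%:Z * (u%:Z + beta - x%:Z)) * gbin B%:Z u%:Z * gbin d (x%:Z - u%:Z)) *
   (q ^ ((i%:Z - u%:Z) * (i%:Z - u%:Z + (u%:Z + beta))) *
    gbin A (i%:Z - u%:Z + (u%:Z + beta)) * gbin (B - u)%N%:Z (i%:Z - u%:Z)).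
transitivity (\sum_(i < B.+1) \sum_(u < B.+1) G i u).
  apply: eq_bigr => i _; rewrite gbin_vandermonde mulr_sumr.
  rewrite [RHS](_ : _ = \sum_(u < i.+1) G i u); last first.
    rewrite (big_ord_widen _ (G i) (ltn_ord i)).
    rewrite [RHS]big_mkcond; apply: eq_bigr => u _; case: ifP => // ui.
    by rewrite /G [gbin _ (i%:Z - u%:Z)]gbin_lt0 ?mulr0 //; lia.
  apply: eq_bigr => u _; rewrite /G.
  have -> : (B - u)%N%:Z = B%:Z - u%:Z.
    by have := ltn_ord i; have := ltn_ord u; lia.
  have -> : i%:Z - u%:Z + (u%:Z + beta) = i%:Z + beta by lia.
  have E : gbin B%:Z u%:Z * gbin (B%:Z - u%:Z) (i%:Z - u%:Z) =
      gbin B%:Z i%:Z * gbin i%:Z u%:Z.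
    rewrite gbin_trinomial (_ : u%:Z + (i%:Z - u%:Z) = i%:Z); last lia.
    by rewrite -gbin_sym.
  rewrite [RHS](_ : _ = q ^ (u%:Z * (u%:Z + beta - x%:Z)) *
     q ^ ((i%:Z - u%:Z) * (i%:Z + beta)) * gbin A (i%:Z + beta) * gbin d (x%:Z - u%:Z) *
     (gbin B%:Z u%:Z * gbin (B%:Z - u%:Z) (i%:Z - u%:Z))); last by ring.
  rewrite E -expfzDr // (_ : u%:Z * (u%:Z + beta - x%:Z) + (i%:Z - u%:Z) * (i%:Z + beta) =
     i%:Z * (i%:Z + beta - x%:Z) + (i%:Z - u%:Z) * (x%:Z - u%:Z)); last by ring.
  by rewrite expfzDr //; ring.
rewrite exchange_big; apply: eq_bigr => u _ /=; rewrite /G -mulr_sumr.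
rewrite gbin_vandermonde_offset; try (by have := ltn_ord u; lia).
by congr (_ * gbin _ _); have := ltn_ord u; lia.
Qed.

(** Here [B+d-x+k;k] is expanded, and the sum over k becomes a q-Vandermonde
    sum, with x lowered by the new summation index. *)
Lemma gbin_triple_product_right (beta d : int) (B x h : nat) :
  \sum_(k < x.+1) q ^ (k%:Z * (k%:Z + beta - x%:Z)) *
     gbin h%:Z (B%:Z + beta - x%:Z + k%:Z) * gbin d (x%:Z - k%:Z) *
     gbin (B%:Z + d - x%:Z + k%:Z) k%:Z =
  \sum_(u < B.+1) q ^ (u%:Z * (u%:Z + beta - x%:Z)) * gbin B%:Z u%:Z *
    gbin d (x%:Z - u%:Z) * gbin (h%:Z + x%:Z - u%:Z) (B%:Z + beta).
Proof.
transitivity (\sum_(k < x.+1) \sum_(u < B.+1)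
   (q ^ (u%:Z * (u%:Z + beta - x%:Z)) * gbin B%:Z u%:Z * gbin d (x%:Z - u%:Z)) *
   (q ^ ((k%:Z - u%:Z) * (k%:Z - u%:Z + (B%:Z + beta - x%:Z + u%:Z))) *
    gbin h%:Z (k%:Z - u%:Z + (B%:Z + beta - x%:Z + u%:Z)) *
    gbin (x%:Z - u%:Z) (k%:Z - u%:Z))).
  apply: eq_bigr => k _; rewrite (_ : B%:Z + d - x%:Z + k%:Z =
    B%:Z + (d - (x%:Z - k%:Z))); last lia.
  rewrite gbin_vandermonde mulr_sumr; apply: eq_bigr => u _.
  have -> : k%:Z - u%:Z + (B%:Z + beta - x%:Z + u%:Z) = B%:Z + beta - x%:Z + k%:Z by lia.
  have E : gbin d (x%:Z - k%:Z) * gbin (d - (x%:Z - k%:Z)) (k%:Z - u%:Z) =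
       gbin d (x%:Z - u%:Z) * gbin (x%:Z - u%:Z) (k%:Z - u%:Z).
    by rewrite gbin_trinomial (_ : x%:Z - k%:Z + (k%:Z - u%:Z) = x%:Z - u%:Z) //; lia.
  rewrite [RHS](_ : _ = q ^ (u%:Z * (u%:Z + beta - x%:Z)) *
     q ^ ((k%:Z - u%:Z) * (B%:Z + beta - x%:Z + k%:Z)) *
     gbin h%:Z (B%:Z + beta - x%:Z + k%:Z) * gbin B%:Z u%:Z *
     (gbin d (x%:Z - u%:Z) * gbin (x%:Z - u%:Z) (k%:Z - u%:Z))); last by ring.
  rewrite -E -expfzDr // (_ : u%:Z * (u%:Z + beta - x%:Z) +
       (k%:Z - u%:Z) * (B%:Z + beta - x%:Z + k%:Z) =
     k%:Z * (k%:Z + beta - x%:Z) + (B%:Z - u%:Z) * (k%:Z - u%:Z)); last by ring.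
  by rewrite expfzDr //; ring.
rewrite exchange_big; apply: eq_bigr => u _ /=; rewrite -mulr_sumr.
case: (leqP u x) => ux; last first.
  by rewrite [gbin d (x%:Z - u%:Z)]gbin_lt0 ?mulr0 ?mul0r //; lia.
have -> : x%:Z - u%:Z = (x - u)%N%:Z by lia.
rewrite gbin_vandermonde_offset //; try lia.
by congr (_ * gbin _ _); lia.
Qed.

(** A transformation between two terminating sums of products of three
    q-binomials: the two preceding lemmas reach the same sum. It holds for all
    integers A, beta and d because a q-binomial with a negative top need not
    vanish; this is needed below, where d may be negative. *)
Lemma gbin_double_sum (A beta d : int) (B x h : nat) : A + B%:Z - x%:Z = h%:Z ->
  \sum_(i < B.+1) q ^ (i%:Z * (i%:Z + beta - x%:Z)) *
     gbin A (i%:Z + beta) * gbin B%:Z i%:Z * gbin (i%:Z + d) x%:Z =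
  \sum_(k < x.+1) q ^ (k%:Z * (k%:Z + beta - x%:Z)) *
     gbin h%:Z (B%:Z + beta - x%:Z + k%:Z) * gbin d (x%:Z - k%:Z) *
     gbin (B%:Z + d - x%:Z + k%:Z) k%:Z.
Proof.
move=> Ah; rewrite gbin_triple_product_right gbin_triple_product_left.
by apply: eq_bigr => u _; congr (_ * gbin _ _); lia.
Qed.

(** * The two chains *)

Section Chains.
Variable L : nat.

Definition weight (j : int) : F := q ^ (j * (j - L%:Z)).

(** Unfolded, a sum over sequences of parts h >= j_1 >= ... >= j_N >= 0
    with beta = sum_k (2 j_k - L). *)
Fixpoint multinomial_chain (N h : nat) (beta : int) : F :=
  if N is N'.+1 then
    \sum_(j < h.+1) weight j%:Z * gbin h%:Z j%:Z *
      multinomial_chain N' j (beta + L%:Z - 2 * j%:Z)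
  else (beta == 0)%:R.

(** Here j = j_1 and x = m_1, and the successive values of x are the m_k, since
    m_k = m_(k+1) + 2 j_(k+1) - L. The chain has one link more than there are
    m_k: the last one belongs to a fictitious part j_(N+1) = 0 and to
    m_(N+1) = L, which together force m_N = 0. With this convention the
    induction can start from N = 0. *)
Fixpoint fermionic_chain (N j : nat) (x : int) : F :=
  if N is N'.+1 then
    \sum_(j' < j.+1) weight j'%:Z * gbin (x + j%:Z - j'%:Z) x *
      fermionic_chain N' j' (x + L%:Z - 2 * j'%:Z)
  else ((j == 0%N) && (x == L%:Z))%:R.

(** The right-hand side with i replaced by B = i + L - j, where j = j_1, for
    general h in place of L and beta in place of l. For fixed B the value
    m_1 = 2 B + beta - L does not depend on j, and the tops of the two attached
    q-binomials are fixed too. K cuts off vanishing terms. *)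
Definition fermionic_sum (N K h : nat) (beta : int) : F :=
  \sum_(B < K) \sum_(j < L.+1) weight j%:Z *
    gbin (B%:Z + beta + h%:Z - L%:Z) (B%:Z + j%:Z - L%:Z + beta) *
    gbin B%:Z (B%:Z + j%:Z - L%:Z) *
    fermionic_chain N j (2 * B%:Z + beta - L%:Z).

Lemma fermionic_chain_supp N (j : nat) x : (j <= L)%N ->
  fermionic_chain N j x != 0 -> (0 <= x) && (x <= (N.+1 * L)%:Z).
Proof.
elim: N j x => [|N IH] j x jL /=.
  by case: andP => [[_ /eqP ->] _|_]; [lia|rewrite eqxx].
move=> h; have [j' ] : exists j' : 'I_j.+1, gbin (x + j%:Z - j'%:Z) x *
      fermionic_chain N j' (x + L%:Z - 2 * j'%:Z) != 0.
  apply/existsP; apply: contraNT h; rewrite negb_exists => /forallP h.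
  apply/eqP/big1 => j' _; move: (h j'); rewrite negbK -mulrA => /eqP ->.
  by rewrite mulr0.
rewrite mulf_eq0 negb_or => /andP[/gbin_neq0[x0 _]].
have jj := ltn_ord j'; move=> /IH; rewrite (leq_trans _ jL) // => /(_ isT).
by rewrite x0 [(N.+2 * L)%N]mulSn; lia.
Qed.

(** This is [gbin_double_sum] with x = 2B + beta - L, A = B + beta + h - L,
    d = B + beta - j2, i = B + j - L and k = B + j' - L. The inequality is
    m_2 >= 0; it makes the terms with j < j2 of the unrestricted sum vanish. *)
Lemma gbin_double_sum_chain (h B j2 : nat) (beta : int) : (h <= L)%N ->
    0 <= 2 * B%:Z + beta - 2 * j2%:Z ->
  \sum_(j < L.+1 | (j2 <= j)%N) weight j%:Z *
    gbin (B%:Z + beta + h%:Z - L%:Z) (B%:Z + j%:Z - L%:Z + beta) *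
    gbin B%:Z (B%:Z + j%:Z - L%:Z) *
    gbin (2 * B%:Z + beta - L%:Z + j%:Z - j2%:Z) (2 * B%:Z + beta - L%:Z) =
  \sum_(j < h.+1) weight j%:Z * gbin h%:Z j%:Z *
    gbin (B%:Z + beta - j2%:Z) (B%:Z + beta - j%:Z) *
    gbin (B%:Z + j%:Z - j2%:Z) (B%:Z + j%:Z - L%:Z).
Proof.
move=> hL y0; case: (ltP (2 * B%:Z + beta - L%:Z) 0) => [xlt0|].
  rewrite !big1 // => j _; last by rewrite [gbin _ (2 * _ + _ - _)]gbin_lt0 ?mulr0.
  case: (ltP (B%:Z + beta - j%:Z) 0) => h1.
    by rewrite [gbin _ (B%:Z + beta - _)]gbin_lt0 ?mulr0 ?mul0r.
  by rewrite [gbin _ (B%:Z + j%:Z - _)]gbin_lt0 ?mulr0 //; lia.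
case Dx: (2 * B%:Z + beta - L%:Z) => [x|] // _.
pose A := B%:Z + beta + h%:Z - L%:Z; pose d := B%:Z + beta - j2%:Z.
pose f i := q ^ (i * (i + beta - x%:Z)) *
     gbin A (i + beta) * gbin B%:Z i * gbin (i + d) x%:Z.
pose g k := q ^ (k * (k + beta - x%:Z)) *
     gbin h%:Z (B%:Z + beta - x%:Z + k) * gbin d (x%:Z - k) *
     gbin (B%:Z + d - x%:Z + k) k.
have fsupp i : f i != 0 -> [&& 0 <= i, i <= B%:Z & j2%:Z <= i - (B%:Z - L%:Z)].
  rewrite /f !mulf_eq0 !negb_or -!andbA => /and4P[_].
  move=> /gbin_neq0[h1 _] /gbin_neq0[h2 h3] /gbin_neq0[_ h4].
  by have := h3 isT; rewrite /d in h4 *; lia.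
have gsupp k : g k != 0 ->
    [&& 0 <= k, k <= x%:Z, B%:Z - L%:Z <= k & k - (B%:Z - L%:Z) <= h%:Z].
  rewrite /g !mulf_eq0 !negb_or -!andbA => /and4P[_].
  by move=> /gbin_neq0[h1 h2] /gbin_neq0[h3 _] /gbin_neq0[h4 _]; have := h2 isT; lia.
have wE j : q ^ ((j + (B%:Z - L%:Z)) * (j + (B%:Z - L%:Z) + beta - x%:Z)) =
    weight j * q ^ (B%:Z * (L%:Z - B%:Z)).
  by rewrite /weight -expfzDr // -Dx; congr (q ^ _); ring.
have Ah : A + B%:Z - x%:Z = h%:Z by rewrite /A; lia.
have := gbin_double_sum beta d Ah.
rewrite (@sum_int_shift _ f B.+1 L.+1 (B%:Z - L%:Z)); last by move=> i /fsupp; lia.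
rewrite (@sum_int_shift _ g x.+1 h.+1 (B%:Z - L%:Z)); last by move=> i /gsupp; lia.
move=> fg; apply: (mulIf (expfz_neq0 (B%:Z * (L%:Z - B%:Z)) q_neq0)).
transitivity (\sum_(j < L.+1) f (j%:Z + (B%:Z - L%:Z))); last first.
  rewrite fg mulr_suml; apply: eq_bigr => j _; rewrite /g wE.
  have -> : B%:Z + beta - x%:Z + (j%:Z + (B%:Z - L%:Z)) = j%:Z by lia.
  have -> : x%:Z - (j%:Z + (B%:Z - L%:Z)) = B%:Z + beta - j%:Z by lia.
  have -> : B%:Z + d - x%:Z + (j%:Z + (B%:Z - L%:Z)) = B%:Z + j%:Z - j2%:Z.
    by rewrite /d; lia.
  have -> : j%:Z + (B%:Z - L%:Z) = B%:Z + j%:Z - L%:Z by ring.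
  by rewrite /d; ring.
rewrite mulr_suml [RHS](bigID (fun j : 'I_L.+1 => (j2 <= j)%N)) /=.
rewrite [X in _ = _ + X]big1 ?addr0 => [|j]; last first.
  by rewrite -ltnNge => jj; apply/eqP; apply: contraTT jj => /fsupp; lia.
apply: eq_bigr => j _; rewrite /f wE -/A.
have -> : x%:Z + j%:Z - j2%:Z = j%:Z + (B%:Z - L%:Z) + d by rewrite /d; lia.
have -> : j%:Z + (B%:Z - L%:Z) = B%:Z + j%:Z - L%:Z by ring.
by ring.
Qed.

(** Induction on N. The sum over j_1 is transformed by [gbin_double_sum_chain]
    for fixed B and j_2; a shift of B by j - j_2 then gives the recursion of
    [multinomial_chain] in the new index j. *)
Lemma fermionic_sum_multinomial N K h beta : (h <= L)%N ->
    (N.+2 * L)%:Z - beta < 2 * K%:Z ->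
  fermionic_sum N K h beta = multinomial_chain N h beta.
Proof.
elim: N K h beta => [|N IH] K h beta hL hK.
  (* For N = 0 only the part 0 counts, and only B = L, which needs beta = 0. *)
  have term0 (B : nat) : B != L \/ beta != 0 ->
      gbin (B%:Z + beta + h%:Z - L%:Z) (B%:Z + 0 - L%:Z + beta) *
      gbin B%:Z (B%:Z + 0 - L%:Z) * (2 * B%:Z + beta - L%:Z == L%:Z)%:R = 0.
    move=> BL; case: eqP => [E|]; last by rewrite mulr0.
    case: (ltP B%:Z L%:Z) => h1.
      by rewrite [gbin _ (_ - L%:Z)]gbin_lt0 ?mulr0 ?mul0r //; lia.
    by rewrite [gbin _ (_ + beta)]gbin_lt0 ?mul0r //; lia.
  have weight0 : weight 0 = 1 by rewrite /weight mul0r expr0z.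
  transitivity (\sum_(B < K) gbin (B%:Z + beta + h%:Z - L%:Z) (B%:Z + 0 - L%:Z + beta) *
      gbin B%:Z (B%:Z + 0 - L%:Z) * (2 * B%:Z + beta - L%:Z == L%:Z)%:R).
    apply: eq_bigr => B _; rewrite big_ord_recl big1 ?addr0 => [|j _].
      by rewrite weight0 mul1r.
    by rewrite mulr0.
  rewrite /=; have [beta0|beta0] := eqVneq beta 0; last first.
    by rewrite big1 // => B _; apply: term0; right.
  have LK : (L < K)%N by rewrite beta0 in hK; lia.
  rewrite (bigD1 (Ordinal LK)) //= big1 ?addr0 => [|B BL]; last by apply: term0; left.
  rewrite beta0 !addr0 subrr !gbin0 !mul1r; case: eqP => // h1.
  by exfalso; apply: h1; lia.
transitivity (\sum_(j < h.+1) weight j%:Z * gbin h%:Z j%:Z *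
      fermionic_sum N K j (beta + L%:Z - 2 * j%:Z)); last first.
  apply: eq_bigr => j _; rewrite IH //; first by have := ltn_ord j; lia.
  by have := ltn_ord j; rewrite mulSn in hK; lia.
pose T (B j j2 : nat) := gbin (B%:Z + beta + h%:Z - L%:Z) (B%:Z + j%:Z - L%:Z + beta) *
    gbin B%:Z (B%:Z + j%:Z - L%:Z) *
    gbin (2 * B%:Z + beta - L%:Z + j%:Z - j2%:Z) (2 * B%:Z + beta - L%:Z).
transitivity (\sum_(j2 < L.+1) \sum_(B < K)
  weight j2%:Z * fermionic_chain N j2 (2 * B%:Z + beta - 2 * j2%:Z) *
  \sum_(j < L.+1 | (j2 <= j)%N) weight j%:Z * T B j j2).
  rewrite exchange_big; apply: eq_bigr => B _ /=.
  under [RHS]eq_bigr do rewrite mulr_sumr big_mkcond.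
  rewrite exchange_big; apply: eq_bigr => j _ /=; rewrite mulr_sumr -big_mkcond.
  rewrite [RHS](big_ord_narrow (ltn_ord j)).
  apply: eq_bigr => j2 _ /=; rewrite /T.
  have -> : 2 * B%:Z + beta - L%:Z + L%:Z - 2 * j2%:Z = 2 * B%:Z + beta - 2 * j2%:Z by ring.
  by ring.
transitivity (\sum_(j2 < L.+1) \sum_(B < K)
  weight j2%:Z * fermionic_chain N j2 (2 * B%:Z + beta - 2 * j2%:Z) *
  \sum_(j < h.+1) weight j%:Z * gbin h%:Z j%:Z *
    gbin (B%:Z + beta - j2%:Z) (B%:Z + beta - j%:Z) *
    gbin (B%:Z + j%:Z - j2%:Z) (B%:Z + j%:Z - L%:Z)).
  apply: eq_bigr => j2 _; apply: eq_bigr => B _.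
  have [->|] := eqVneq (fermionic_chain N j2 (2 * B%:Z + beta - 2 * j2%:Z)) 0.
    by rewrite mulr0 !mul0r.
  move/fermionic_chain_supp => /(_ (ltn_ord j2))/andP[y0 _]; congr (_ * _).
  by rewrite -gbin_double_sum_chain //; apply: eq_bigr => j _; rewrite !mulrA.
under eq_bigr => j2 _ do under eq_bigr do rewrite mulr_sumr.
under eq_bigr => j2 _ do rewrite exchange_big.
rewrite exchange_big; apply: eq_bigr => j _ /=.
rewrite /fermionic_sum [in RHS]exchange_big mulr_sumr; apply: eq_bigr => j2 _ /=.
pose f B := weight j%:Z * gbin h%:Z j%:Z * (weight j2%:Z *
    gbin (B + (beta + L%:Z - 2 * j%:Z) + j%:Z - L%:Z)
         (B + j2%:Z - L%:Z + (beta + L%:Z - 2 * j%:Z)) *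
    gbin B (B + j2%:Z - L%:Z) *
    fermionic_chain N j2 (2 * B + (beta + L%:Z - 2 * j%:Z) - L%:Z)).
(* Both terms have the same m_2 if B is replaced by B + j - j2 on the right. *)
rewrite mulr_sumr [RHS](@sum_int_shift _ f K K (j%:Z - j2%:Z)); last first.
  move=> B; rewrite /f !mulf_eq0 !negb_or -!andbA.
  case/and5P=> _ _ _ _ /andP[/gbin_neq0[h1 _]].
  move/fermionic_chain_supp => /(_ (ltn_ord j2))/andP[y0 y1].
  by have := ltn_ord j; have := ltn_ord j2; rewrite !mulSn in hK y1; lia.
apply: eq_bigr => B _; rewrite /f.
have -> : B%:Z + (j%:Z - j2%:Z) + (beta + L%:Z - 2 * j%:Z) + j%:Z - L%:Z =
   B%:Z + beta - j2%:Z by ring.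
have -> : B%:Z + (j%:Z - j2%:Z) + j2%:Z - L%:Z + (beta + L%:Z - 2 * j%:Z) =
   B%:Z + beta - j%:Z by ring.
have -> : B%:Z + (j%:Z - j2%:Z) + j2%:Z - L%:Z = B%:Z + j%:Z - L%:Z by ring.
have -> : B%:Z + (j%:Z - j2%:Z) = B%:Z + j%:Z - j2%:Z by ring.
have -> : 2 * (B%:Z + j%:Z - j2%:Z) + (beta + L%:Z - 2 * j%:Z) - L%:Z =
   2 * B%:Z + beta - 2 * j2%:Z by ring.
by ring.
Qed.

(** * Chains as sums over partitions *)

Fixpoint weight_prod (s : seq nat) : F :=
  if s is j :: s' then weight j%:Z * weight_prod s' else 1.

(** [qpoch_inv] on integers, see [qpoch_invE]. *)
Definition qpoch_invz (x : int) : F := if x is Posz n then (qpoch q n)^-1 else 0.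

Fixpoint gap_invs (h : nat) (s : seq nat) : F :=
  if s is j :: s' then qpoch_invz (h%:Z - j%:Z) * gap_invs j s' else qpoch_invz h%:Z.

(** With s = (j_(k+1), ..., j_N) and j = j_k, the sum x is m_k. The indicator
    stands for n_k >= 0. *)
Fixpoint fermionic_steps (j : nat) (s : seq nat) : F :=
  if s is j' :: s' then
    let x := \sum_(i <- s) (2 * i%:Z - L%:Z) in
    (j' <= j)%N%:R * gbin (x + j%:Z - j'%:Z) x * fermionic_steps j' s'
  else 1.

Lemma gbin_qpoch_invz (h j : nat) :
  gbin h%:Z j%:Z = qpoch q h * (qpoch_invz (h%:Z - j%:Z) * qpoch_invz j%:Z).
Proof.
case: (leqP j h) => jh; last first.
  by rewrite gbin_small ?ltz_nat //; case E: (h%:Z - j%:Z) => [n|n]; [lia|rewrite mul0r mulr0].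
rewrite -(subnKC jh) (_ : (j + (h - j))%:Z - j%:Z = (h - j)%N%:Z) /=; last lia.
by rewrite gbin_nat // invfM [X in _ = _ * X]mulrC.
Qed.

Lemma sum_tupleS (T : finType) n (f : seq T -> F) :
  \sum_(t : n.+1.-tuple T) f t = \sum_(x : T) \sum_(t : n.-tuple T) f (x :: t).
Proof.
rewrite pair_big /= (reindex (fun p : T * n.-tuple T => [tuple of p.1 :: p.2])) //=.
exists (fun t => (thead t, [tuple of behead t])) => [[x t] _|t _] /=.
  by congr (_, _); apply: val_inj.
by rewrite [RHS]tuple_eta; apply: val_inj.
Qed.

Lemma sum_tuple0 (T : finType) (f : seq T -> F) : \sum_(t : 0.-tuple T) f t = f [::].
Proof.
rewrite (bigD1 [tuple]) //= big1 ?addr0 // => t /negP[].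
by apply/eqP; exact: tuple0.
Qed.

Definition nats (s : seq 'I_L.+1) : seq nat := [seq val i | i <- s].

(** The product of the [j_(k-1); j_k] telescopes to a q-multinomial coefficient. *)
Lemma multinomial_chainE N h beta : (h <= L)%N ->
  multinomial_chain N h beta =
  \sum_(t : N.-tuple 'I_L.+1 | beta + (N * L)%:Z == 2 * (\sum_(j <- nats t) j)%N%:Z)
    weight_prod (nats t) * (qpoch q h * gap_invs h (nats t)).
Proof.
elim: N h beta => [|N IH] h beta hL /=.
  rewrite big_mkcond /= (sum_tuple0 (fun s => if beta + (0 * L)%:Z ==
   2 * (\sum_(j <- nats s) j)%N%:Z then
   weight_prod (nats s) * (qpoch q h * gap_invs h (nats s)) else 0)).
  rewrite big_nil mul0n mulr0 addr0 mul1r divff ?qpoch_neq0 //.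
  by case: eqP.
rewrite [RHS]big_mkcond /= (sum_tupleS N (fun s => if beta + (N.+1 * L)%:Z ==
   2 * (\sum_(j <- nats s) j)%N%:Z then
   weight_prod (nats s) * (qpoch q h * gap_invs h (nats s)) else 0)).
rewrite (big_ord_widen L.+1 (fun j : nat => weight j%:Z * gbin h%:Z j%:Z *
      multinomial_chain N j (beta + L%:Z - 2 * j%:Z))) // big_mkcond /=.
apply: eq_bigr => j _; rewrite gbin_qpoch_invz ltnS.
have [jh|jh] := leqP j h; last first.
  rewrite big1 // => t _; case: ifP => // _; case E: (h%:Z - j%:Z) => [n|n]; first lia.
  by rewrite mul0r !mulr0.
rewrite IH ?(leq_trans jh) // mulr_sumr big_mkcond; apply: eq_bigr => t _ /=.
rewrite big_cons; set S := (\sum_(j <- _) j)%N.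
have -> : (beta + L%:Z - 2 * j%:Z + (N * L)%:Z == 2 * S%:Z) =
  (beta + (N.+1 * L)%:Z == 2 * (j + S)%N%:Z) by rewrite mulSn; lia.
case: ifP => // _; field; exact: qpoch_neq0.
Qed.

Lemma sum_slopes (s : seq nat) : \sum_(i <- s) (2 * i%:Z - L%:Z) =
  2 * (\sum_(i <- s) i)%N%:Z - (size s * L)%:Z.
Proof.
elim: s => [|i s IH]; first by rewrite !big_nil mul0n mulr0 subr0.
by rewrite !big_cons IH /= mulSn; lia.
Qed.

Lemma fermionic_chainS N j x : fermionic_chain N.+1 j x =
  \sum_(j' < j.+1) weight j'%:Z * gbin (x + j%:Z - j'%:Z) x *
      fermionic_chain N j' (x + L%:Z - 2 * j'%:Z).
Proof. by []. Qed.

Arguments fermionic_chain : simpl never.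

Lemma fermionic_chainE N j x : (j <= L)%N ->
  fermionic_chain N.+1 j x =
  \sum_(t : N.-tuple 'I_L.+1 | x + (N * L)%:Z == 2 * (\sum_(i <- nats t) i)%N%:Z)
    weight_prod (nats t) * fermionic_steps j (nats t).
Proof.
elim: N j x => [|N IH] j x jL.
  rewrite big_mkcond /= (sum_tuple0 (fun s => if x + (0 * L)%:Z ==
   2 * (\sum_(j <- nats s) j)%N%:Z then
   weight_prod (nats s) * fermionic_steps j (nats s) else 0)) /=.
  rewrite big_nil mul0n mulr0 addr0 mul1r fermionic_chainS.
  rewrite big_ord_recl big1 ?addr0 => [|i _]; last first.
    by rewrite /fermionic_chain mulr0.
  rewrite /fermionic_chain /= /weight mul0r expr0z mul1r.
  case: (eqVneq x 0) => [->|x0]; first by rewrite gbin0 mul1r add0r eqxx.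
  case: eqP => h; last by rewrite mulr0.
  by exfalso; lia.
rewrite fermionic_chainS.
rewrite [RHS]big_mkcond /= (sum_tupleS N (fun s => if x + (N.+1 * L)%:Z ==
   2 * (\sum_(j <- nats s) j)%N%:Z then weight_prod (nats s) * fermionic_steps j (nats s) else 0)).
rewrite (big_ord_widen L.+1 (fun j' : nat => weight j'%:Z * gbin (x + j%:Z - j'%:Z) x *
      fermionic_chain N.+1 j' (x + L%:Z - 2 * j'%:Z))) // big_mkcond /=.
apply: eq_bigr => j' _; rewrite ltnS.
have [jj|jj] := leqP j' j; last first.
  by rewrite big1 // => t _; case: ifP => // _; rewrite !mul0r mulr0.
rewrite IH ?(leq_trans jj) // mulr_sumr big_mkcond; apply: eq_bigr => t _ /=.
rewrite !big_cons; set S := (\sum_(j <- _) j)%N; set S' := \sum_(j <- _) _.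
have ES : S' = 2 * S%:Z - (N * L)%:Z.
  by rewrite /S' sum_slopes size_map size_tuple.
have -> : (x + L%:Z - 2 * j'%:Z + (N * L)%:Z == 2 * S%:Z) =
  (x + (N.+1 * L)%:Z == 2 * (j' + S)%N%:Z) by rewrite mulSn; lia.
case: ifP => // /eqP xE; have -> : 2 * j'%:Z - L%:Z + S' = x.
  by rewrite ES; rewrite mulSn in xE; lia.
by ring.
Qed.

End Chains.

End GaussianBinomials.

(** * Partitions and the Cartan matrix *)

(** Summation by parts, as for [abel_partial_sums]: the minimum grows by 1 up
    to k and is constant from there on. *)
Lemma abel_min (f : nat -> rat) (k n : nat) : (k <= n)%N ->
  \sum_(i < n) (minn k i.+1)%:R * (f i - f i.+1) = \sum_(t < k) f t - k%:R * f n.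
Proof.
elim: n k => [|n IH] k.
  by rewrite leqn0 => /eqP ->; rewrite !big_ord0 mul0r subr0.
rewrite leq_eqVlt ltnS => /predU1P[->|kn].
  transitivity (\sum_(i < n) (minn n i.+1)%:R * (f i - f i.+1) + n.+1%:R * (f n - f n.+1)).
    rewrite big_ord_recr /= minnn; congr (_ + _); apply: eq_bigr => i _.
    by rewrite !(minn_idPr _) // ltnW ?ltn_ord // ltnS ltn_ord.
  rewrite IH // [in RHS]big_ord_recr /= -natr1; ring.
rewrite big_ord_recr /= IH // (minn_idPl _) ?(leq_trans kn) //; ring.
Qed.

Lemma abel_partial_sums (f : nat -> rat) (n : nat) :
  \sum_(k < n) (f k - f k.+1) * (\sum_(t < k.+1) f t) =
  \sum_(k < n.+1) f k ^+ 2 - f n * \sum_(t < n.+1) f t.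
Proof.
elim: n => [|n IH]; first by rewrite big_ord0 !big_ord1 expr2 subrr.
rewrite [LHS]big_ord_recr IH /=.
rewrite [\sum_(k < n.+2) _]big_ord_recr [\sum_(t < n.+2) f t]big_ord_recr /=; ring.
Qed.

Section Partitions.
Variable r : nat.
Variable J : nat -> int.

Definition gaps : 'cV[int]_r := \col_(k < r) (J k - J k.+1).

Let Jr (k : nat) : rat := (J k)%:~R.
Let S : rat := \sum_(t < r.+1) Jr t.

Lemma lastv_gaps : lastv (Cinvv (ratv gaps)) = S / r.+1%:R - Jr r.
Proof.
rewrite lastvE.
have -> : \sum_(j < r) j.+1%:R / r.+1%:R * ratv gaps j 0 =
    (\sum_(j < r) (minn r j.+1)%:R * (Jr j - Jr j.+1)) / r.+1%:R.
  rewrite mulr_suml; apply: eq_bigr => j _.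
  by rewrite !mxE intrB (minn_idPr (ltn_ord j)) mulrAC.
rewrite abel_min // /S big_ord_recr /= -[r.+1%:R]natr1; field.
by rewrite natr1 pnatr_eq0.
Qed.

Lemma firstv_gaps : firstv (Cinvv (ratv gaps)) = Jr 0 - S / r.+1%:R.
Proof.
have -> : firstv (Cinvv (ratv gaps)) = \sum_i ratv gaps i 0 - lastv (Cinvv (ratv gaps)).
  by rewrite lastv_firstv subKr.
have -> : \sum_i ratv gaps i 0 = \sum_(i < r) (minn 1 i.+1)%:R * (Jr i - Jr i.+1).
  by apply: eq_bigr => i _; rewrite !mxE intrB (minn_idPl _) // mul1r.
rewrite lastv_gaps; case: (posnP r) => [r0|r_gt0].
  by rewrite /S r0 big_ord0 big_ord1 divr1; ring.
by rewrite abel_min // big_ord1; ring.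
Qed.

(** The right-hand side has second differences J_(k+1) - J_k, and extended to
    all of 0, ..., N it vanishes at both ends. *)
Lemma Cinvv_gaps (j : 'I_r) :
  Cinvv (ratv gaps) j 0 = \sum_(t < j.+1) Jr t - j.+1%:R * (S / r.+1%:R).
Proof.
rewrite /Cinvv invmx_cartan mxE.
transitivity (\sum_(i < r) (minn j.+1 i.+1)%:R * (Jr i - Jr i.+1) -
    j.+1%:R * lastv (Cinvv (ratv gaps))).
  rewrite lastvE mulr_sumr -sumrB; apply: eq_bigr => i _.
  by rewrite !mxE intrB natrM -/(Jr i) -/(Jr i.+1); ring.
by rewrite abel_min // lastv_gaps; ring.
Qed.

Lemma Cform_gaps :
  Cform (ratv gaps) = \sum_(t < r.+1) Jr t ^+ 2 - S ^+ 2 / r.+1%:R.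
Proof.
rewrite /Cform -mulmxA mxE.
have -> : \sum_j (ratv gaps)^T 0 j * (invmx (cartan r) *m ratv gaps) j 0 =
  \sum_(j < r) (Jr j - Jr j.+1) * (\sum_(t < j.+1) Jr t) -
  (\sum_(j < r) (minn r j.+1)%:R * (Jr j - Jr j.+1)) * (S / r.+1%:R).
  rewrite mulr_suml -sumrB; apply: eq_bigr => j _.
  rewrite -[_ *m _]/(Cinvv (ratv gaps)) Cinvv_gaps !mxE intrB -/(Jr j) -/(Jr j.+1).
  by rewrite (minn_idPr (ltn_ord j)); ring.
rewrite abel_partial_sums abel_min //.
have -> : \sum_(t < r) Jr t - r%:R * Jr r = S - r.+1%:R * Jr r.
  by rewrite /S big_ord_recr /= -natr1; ring.
rewrite -/S; field.
by rewrite ?(natr1, nat1r) pnatr_eq0.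
Qed.

Lemma mvec_gaps (L : nat) (j : 'I_r) :
  mvec (2 * (\sum_(t < r.+1) J t) - (r.+1 * L)%:Z) gaps j 0 =
  (\sum_(j.+1 <= t < r.+1) (2 * J t - L%:Z))%:~R.
Proof.
have SE : (\sum_(t < r.+1) J t)%:~R = S by rewrite rmorph_sum.
rewrite mvecE lastv_gaps.
have -> : \sum_(i < r) (minn j.+1 i.+1)%:R * ratv gaps i 0 =
    \sum_(i < r) (minn j.+1 i.+1)%:R * (Jr i - Jr i.+1).
  by apply: eq_bigr => i _; rewrite !mxE intrB.
rewrite abel_min // intrB intrM SE.
rewrite sumrB -mulr_sumr sumr_const_nat intrB intrM.
have -> : \sum_(j.+1 <= t < r.+1) J t = \sum_(t < r.+1) J t - \sum_(t < j.+1) J t.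
  rewrite -!(big_mkord xpredT J) [X in _ = X - _](@big_cat_nat _ _ _ j.+1) //=; last first.
    by rewrite ltnS ltnW.
  by rewrite [X in _ = X - _]addrC addrK.
rewrite intrB SE rmorph_sum /= -/Jr.
have -> : (L%:Z *+ (r.+1 - j.+1))%:~R = (r.+1%:R - j.+1%:R) * L%:R :> rat.
  rewrite -natrB; last by rewrite ltnS ltnW.
  by rewrite rmorphMn /= -mulr_natl.
rewrite -[(r.+1 * L)%:Z%:~R]/((r.+1 * L)%:R) natrM; field.
by rewrite ?(natr1, nat1r) pnatr_eq0.
Qed.

Lemma firstv_mvec_gaps (L : nat) :
  firstv (mvec (2 * (\sum_(t < r.+1) J t) - (r.+1 * L)%:Z) gaps) =
  (\sum_(1 <= t < r.+1) (2 * J t - L%:Z))%:~R.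
Proof.
case: (posnP r) => [r0|h].
  rewrite big_geq ?r0 // /firstv /coordv; case: insubP => // i _ _.
  by have := ltn_ord i; lia.
rewrite -[1%N]/((Ordinal h).+1) -mvec_gaps /firstv /coordv.
case: insubP => [i _ i0|]; last by rewrite h.
by congr (mvec _ _ _ _); apply: val_inj.
Qed.

End Partitions.

Definition part (s : seq nat) (k : nat) : int := (nth 0%N s k)%:Z.

Lemma sum_part (s : seq nat) (G : int -> int) :
  \sum_(i <- s) G i%:Z = \sum_(t < size s) G (part s t).
Proof. by rewrite (big_nth 0%N) big_mkord. Qed.

Lemma Posz_sum (s : seq nat) : (\sum_(i <- s) i)%N%:Z = \sum_(i <- s) i%:Z.
Proof. exact: (big_morph Posz PoszD erefl). Qed.

Lemma size_nats L n (t : n.-tuple 'I_L.+1) : size (nats t) = n.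
Proof. by rewrite size_map size_tuple. Qed.

(** A sequence with sum S is recovered from its gaps n, as its first term is
    S/N + (C^-1 n)_1; conversely n comes from such a sequence if this number is
    an integer. *)
Lemma fsum_gaps (V : nmodType) (r L : nat) (S : int) (f : 'cV[int]_r -> V) :
  (forall J : nat -> int, \sum_(t < r.+1) J t = S -> f (gaps r J) != 0 ->
     forall t : 'I_r.+1, 0 <= J t <= L%:Z) ->
  \sum_(n \in [set n : 'cV[int]_r |
     S%:~R / r.+1%:R + firstv (Cinvv (ratv n)) \is a Num.int]) f n =
  \sum_(t : r.+1.-tuple 'I_L.+1 | (\sum_(i <- nats t) i)%N%:Z == S)
     f (gaps r (part (nats t))).
Proof.
move=> hf.
have sumE (t : r.+1.-tuple 'I_L.+1) :
    \sum_(k < r.+1) part (nats t) k = (\sum_(i <- nats t) i)%N%:Z.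
  by rewrite Posz_sum (sum_part _ id) size_nats.
have firstE (J : nat -> int) : \sum_(t < r.+1) J t = S ->
    S%:~R / r.+1%:R + firstv (Cinvv (ratv (gaps r J))) = (J 0%N)%:~R.
  by move=> <-; rewrite firstv_gaps rmorph_sum /=; ring.
pose cond (t : r.+1.-tuple 'I_L.+1) := (\sum_(i <- nats t) i)%N%:Z == S.
pose s := [seq gaps r (part (nats (tval t))) | t : r.+1.-tuple 'I_L.+1 <- enum cond].
rewrite (@fsbigE _ _ _ _ _ s) /=.
- rewrite big_map big_enum_cond; apply: eq_bigl => t /=.
  apply/andP/idP => [[]//|tS]; split; first exact: tS.
  by apply/mem_set; rewrite /= firstE ?intr_int // sumE; apply/eqP.
- rewrite map_inj_in_uniq ?enum_uniq // => t u; rewrite !mem_enum => /eqP ht /eqP hu E.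
  have eq0 : part (nats t) 0 = part (nats u) 0.
    apply: (@intr_inj rat); rewrite -firstE ?sumE // -[RHS]firstE ?sumE //.
    by rewrite E.
  have eqk k : (k < r.+1)%N -> part (nats t) k = part (nats u) k.
    elim: k => [//|k IH] kr.
    have := congr1 (fun v : 'cV[int]_r => v (Ordinal (kr : (k < r)%N)) 0) E.
    by rewrite !mxE /= IH 1?ltnW // => /addrI/oppr_inj.
  apply: val_inj; apply: (inj_map val_inj).
  apply: (@eq_from_nth _ 0%N); first by rewrite !size_nats.
  by move=> k; rewrite size_nats => /eqk [].
- move=> n /= /mapP[t]; rewrite mem_enum => /eqP ht ->.
  by rewrite firstE ?sumE // intr_int.
- move=> n /intrP[c Ec]; apply: contraNeq => fn0; apply/mapP.
  pose J (k : nat) := c - \sum_(i < r | (i < k)%N) n i 0.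
  have JE : gaps r J = n.
    apply/matrixP => k j; rewrite ord1 mxE /J.
    rewrite [X in _ - (_ - X)](bigD1 k) //= [X in _ - (_ - (_ + X))](eq_bigl
       (fun i : 'I_r => (i < k)%N)); first by ring.
    by move=> i; rewrite -val_eqE /= ltnS ltn_neqAle andbC.
  have Jsum : \sum_(t < r.+1) J t = S.
    have := firstv_gaps r J; rewrite JE {1}/J big_pred0 // subr0 -Ec.
    rewrite -rmorph_sum => h; apply: (@intr_inj rat).
    have rN0 : (r.+1%:R : rat) != 0 by rewrite pnatr_eq0.
    apply: (divIf rN0).
    by move: h; rewrite addrAC -[LHS]add0r => /addIr/esym/subr0_eq ->.
  have Jbd := hf J Jsum; rewrite JE in Jbd; move: Jbd => /(_ fn0) Jbd.
  pose t := [tuple (inord `|J k|%N : 'I_L.+1) | k < r.+1].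
  have tE k : (k < r.+1)%N -> part (nats t) k = J k.
    move=> kr; have := Jbd (Ordinal kr); rewrite /part /nats /=.
    rewrite (nth_map ord0) ?size_tuple ?card_ord //.
    have -> : nth ord0 t k = inord `|J k|%N := nth_mktuple _ ord0 (Ordinal kr).
    by rewrite /=; move: (J k) => a ha; rewrite inordK; lia.
  exists t.
    rewrite mem_enum; apply/eqP; rewrite -sumE -Jsum.
    by apply: eq_bigr => k _; rewrite tE.
  rewrite -JE; apply/matrixP => k j; rewrite !mxE !tE ?ltnS ?ltn_ord //.
  exact: ltnW.
Qed.

(** * The summands in terms of partitions *)

Lemma intr_isnat (k : int) : ((k%:~R : rat) \is a Num.nat) = (0 <= k).
Proof. by rewrite natrEint intr_int ler0z. Qed.

Lemma qpoch_invE (F : fieldType) (q : F) (x : int) : qpoch_inv q x%:~R = qpoch_invz q x.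
Proof.
rewrite /qpoch_inv intr_isnat; case: x => n //.
by rewrite natrK.
Qed.

Lemma qbinomE (F : fieldType) (q : F)
    (q_nroot : forall k : nat, (0 < k)%N -> q ^+ k != 1)
    (t k : int) :
  qbinom q t%:~R k%:~R = (0 <= t - k)%R%:R * gbin q t k.
Proof.
rewrite /qbinom -intrB !intr_isnat.
case: (ltP (t - k) 0) => tk; first by rewrite andbF mul0r.
case: k tk => k tk; last by rewrite gbin_lt0 ?mulr0.
case E : (t - k%:Z) tk => [n|n] // _.
have -> : t = (k + n)%N%:Z by lia.
by rewrite /= mul1r gbin_nat // -!pmulrn !natrK.
Qed.

Lemma qpowE (F : fieldType) (z : F) N (x : rat) (k : int) :
  N%:R * x = k%:~R -> qpow N z x = z ^ k.
Proof. by move=> E; rewrite /qpow E intrKfloor. Qed.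

Section ClosedForms.
Variables (F : fieldType) (q : F) (L : nat).

Lemma weight_prod_exp s : q != 0 -> weight_prod q L s = q ^ (\sum_(j <- s) j%:Z * (j%:Z - L%:Z)).
Proof.
move=> q0; elim: s => [|j s IH]; first by rewrite big_nil expr0z.
by rewrite big_cons expfzDr // -IH.
Qed.

Lemma gap_invs_prod (j : nat) s : gap_invs q j s =
  qpoch_invz q (part (j :: s) (size s)) *
  \prod_(k < size s) qpoch_invz q (part (j :: s) k - part (j :: s) k.+1).
Proof.
elim: s j => [|j' s IH] j; first by rewrite big_ord0 mulr1.
by rewrite big_ord_recl /= IH mulrCA.
Qed.

Lemma fermionic_steps_prod (j : nat) s : fermionic_steps q L j s =
  \prod_(k < size s) ((0 <= part (j :: s) k - part (j :: s) k.+1)%R%:R *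
     let x := \sum_(k.+1 <= t < (size s).+1) (2 * part (j :: s) t - L%:Z) in
     gbin q (x + (part (j :: s) k - part (j :: s) k.+1)) x).
Proof.
elim: s j => [|j' s IH] j; first by rewrite big_ord0.
rewrite big_ord_recl [LHS]/= IH; congr (_ * _ * _).
- by rewrite /part /= subr_ge0.
- rewrite /part /= big_add1 /= big_mkord.
  by rewrite (sum_part (j' :: s) (fun i => 2 * i - L%:Z)) addrA.
- apply: eq_bigr => k _; rewrite /part /= /bump /= add1n.
  by rewrite [in RHS]big_add1.
Qed.

End ClosedForms.

(** * The two sides of the theorem *)

Section Translation.
Variables (F : fieldType) (z : F) (r L s : nat) (l : int).
Hypothesis z_neq0 : z != 0.
Local Notation N := r.+1.
Local Notation q := (z ^+ N).
Hypothesis q_nroot : forall k : nat, (0 < k)%N -> q ^+ k != 1.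
Hypothesis lE : l = - (N * L)%:Z + 2 * s%:Z.

Let q_neq0 : q != 0. Proof. exact: expf_neq0. Qed.
Let NQ_neq0 : (N%:R : rat) != 0. Proof. by rewrite pnatr_eq0. Qed.

(** With S = s this is the common power q^(L s - s^2/N) times the weights. *)
Lemma qpow_Cform_gaps (J : seq nat) : size J = N ->
  let S := (\sum_(j <- J) j)%N in
  qpow N z (Cform (ratv (gaps r (part J)))) =
  z ^ ((N * L * S)%:Z - (S * S)%:Z) * weight_prod q L J.
Proof.
move=> sJ S; rewrite weight_prod_exp // exprnP exprz_exp -expfzDr //.
apply: qpowE; rewrite Cform_gaps.
have -> : \sum_(t < N) (part J t)%:~R = S%:R :> rat.
  rewrite -[S%:R]/(S%:Z%:~R) Posz_sum (sum_part _ id) sJ rmorph_sum.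
  by apply: eq_bigr.
have -> : \sum_(t < N) (part J t)%:~R ^+ 2 = (\sum_(j <- J) j%:Z ^+ 2)%:~R :> rat.
  rewrite (sum_part _ (fun j => j ^+ 2)) sJ rmorph_sum.
  by apply: eq_bigr => t _; rewrite rmorphXn.
have -> : \sum_(j <- J) j%:Z * (j%:Z - L%:Z) = \sum_(j <- J) j%:Z ^+ 2 - S%:Z * L%:Z.
  rewrite Posz_sum mulr_suml -sumrB; apply: eq_bigr => j _; ring.
set Q := \sum_(j <- J) _.
rewrite mulrBr mulrC [N%:R * (_ / _)]mulrCA divff // mulr1.
rewrite !(intrD, intrB, intrM) !PoszM !intrM -!pmulrn.
by rewrite !intrN !intrM -!pmulrn; ring.
Qed.

Let lQ : l%:~R = 2 * s%:R - N%:R * L%:R :> rat.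
Proof. by rewrite lE intrD intrN PoszM !intrM -!pmulrn; ring. Qed.

Lemma boolr_neq0 (b : bool) : ((b%:R : F) != 0) = b.
Proof. by case: b; rewrite ?oner_neq0 ?eqxx. Qed.

Lemma qpoch_invz_ge0 (x : int) : qpoch_invz q x != 0 -> 0 <= x.
Proof. by case: x => //= n; rewrite eqxx. Qed.

Lemma partition_bounds (J : nat -> int) :
  (forall k, (k < r)%N -> J k.+1 <= J k) -> 0 <= J r -> J 0%N <= L%:Z ->
  forall t : 'I_N, 0 <= J t <= L%:Z.
Proof.
move=> dec Jr J0 t.
have up k : (k <= r)%N -> J k <= L%:Z.
  elim: k => // k IH kr; apply: le_trans (dec k kr) (IH _); exact: ltnW.
have down k : (k <= r)%N -> 0 <= J (r - k)%N.
  elim: k => [|k IH] kr; first by rewrite subn0.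
  apply: le_trans (IH (ltnW kr)) _.
  have := dec (r - k.+1)%N; rewrite subnSK //; apply.
  lia.
have tr : (t <= r)%N := ltn_ord t.
by rewrite up // andbT -(subKn tr) down ?leq_subr.
Qed.

Lemma sum_gapsE (J : nat -> int) (S : nat) : \sum_(t < N) J t = S%:Z ->
  \sum_(t < N) (J t)%:~R = S%:R :> rat.
Proof. by move=> JS; rewrite -[S%:R]/(S%:Z%:~R) -JS rmorph_sum. Qed.

Lemma qmultinomialE : qmultinomial N z L (l%:~R / 2) =
  z ^ ((N * L * s)%:Z - (s * s)%:Z) * multinomial_chain q L N L l.
Proof.
rewrite /qmultinomial multinomial_chainE // mulr_sumr.
have aE : L%:R / 2 + l%:~R / 2 / N%:R = s%:Z%:~R / N%:R :> rat.
  by rewrite lQ -pmulrn; field; rewrite ?(natr1, nat1r).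
have bE : L%:R / 2 - l%:~R / 2 / N%:R = L%:R - s%:Z%:~R / N%:R :> rat.
  by rewrite lQ -pmulrn; field; rewrite ?(natr1, nat1r).
rewrite aE bE.
have firstE (J : nat -> int) : \sum_(t < N) J t = s%:Z ->
    L%:R - s%:Z%:~R / N%:R - firstv (Cinvv (ratv (gaps r J))) = (L%:Z - J 0%N)%:~R.
  by move/sum_gapsE => Js; rewrite firstv_gaps Js intrB -pmulrn; ring.
have lastE (J : nat -> int) : \sum_(t < N) J t = s%:Z ->
    s%:Z%:~R / N%:R - lastv (Cinvv (ratv (gaps r J))) = (J r)%:~R.
  by move/sum_gapsE => Js; rewrite lastv_gaps Js -pmulrn; ring.
rewrite (@fsum_gaps _ r L s%:Z); last first.
  move=> J Js; rewrite firstE // lastE // !qpoch_invE !mulf_eq0 !negb_or -!andbA.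
  case/and5P=> _ _ /qpoch_invz_ge0 h1 /qpoch_invz_ge0 h2 /prodf_neq0 h3.
  apply: partition_bounds => // [k kr|]; last by rewrite -subr_ge0.
  by have := h3 (Ordinal kr) isT; rewrite mxE qpoch_invE mxE => /qpoch_invz_ge0; rewrite subr_ge0.
apply: eq_big => [t|t /eqP].
  by rewrite lE; lia.
case/tupleP: t => j t St; set J := nats _ in St *.
have sJ : size J = N by rewrite size_nats.
have Js : \sum_(k < N) part J k = s%:Z by rewrite -St Posz_sum (sum_part _ id) sJ.
rewrite firstE // lastE // !qpoch_invE qpow_Cform_gaps // (_ : (\sum_(i <- J) i)%N = s); last lia.
rewrite /J /= gap_invs_prod !size_nats.
rewrite (eq_bigr (fun k : 'I_r => qpoch_invz q (part (val j :: nats t) k -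
   part (val j :: nats t) k.+1))); last by move=> k _; rewrite mxE qpoch_invE mxE.
by rewrite /=; ring.
Qed.

(** The fermionic sum has n at the bottom, the chain has x = m at the bottom;
    the q-binomial with a nonnegative top is symmetric. *)
Lemma gbin_swap (x n : int) :
  (0 <= x)%R%:R * gbin q (x + n) n = (0 <= n)%R%:R * gbin q (x + n) x.
Proof.
case: (ltP x 0) => x0; case: (ltP n 0) => n0; rewrite ?mul0r // ?mul1r.
- by rewrite gbin_lt0 ?mulr0.
- by rewrite gbin_lt0.
case: x n x0 n0 => [x|//] [n|//] _ _.
by rewrite -PoszD gbin_sym // (_ : (x + n)%N%:Z - n%:Z = x%:Z) //; lia.
Qed.

(** The i-th summand without the common factor: for j = j_1 and B = i + L - j
    these are the summands of [fermionic_sum] at h = L and beta = l. *)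
Definition fermionic_term (i : nat) : F := \sum_(j < L.+1) weight q L j%:Z *
  gbin q (i%:Z + l + L%:Z - j%:Z) (i%:Z + l) * gbin q (i%:Z + L%:Z - j%:Z) i%:Z *
  fermionic_chain q L N j (2 * i%:Z + l + L%:Z - 2 * j%:Z).

Lemma fermionic_sumE (i : nat) :
  qpow N z (i%:R * (i%:R + l%:~R) / N%:R) *
    \sum_(n \in [set n : 'cV[int]_r |
                 L%:R / 2 + (2 * i%:R + l%:~R) / (2 * N%:R)
                 + firstv (Cinvv (ratv n)) \is a Num.int])
      (let m := mvec (2 * i%:Z + l) n in
      qpow N z (Cform (ratv n)) * qbinomv q (m + ratv n) (ratv n)
      * qbinom q ((L%:R + l%:~R + firstv m) / 2) (i%:R + l%:~R)
      * qbinom q ((L%:R - l%:~R + firstv m) / 2) i%:R) =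
  z ^ ((N * L * s)%:Z - (s * s)%:Z) * fermionic_term i.
Proof.
have -> : L%:R / 2 + (2 * i%:R + l%:~R) / (2 * N%:R) = (s + i)%N%:Z%:~R / N%:R :> rat.
  by rewrite lQ -pmulrn natrD; field; rewrite ?(natr1, nat1r).
have kE (J : nat -> int) : \sum_(t < N) J t = (s + i)%N%:Z ->
    2 * i%:Z + l = 2 * (\sum_(t < N) J t) - (N * L)%:Z.
  by move=> ->; rewrite lE; lia.
have termE (J : nat -> int) : \sum_(t < N) J t = (s + i)%N%:Z ->
  let m := mvec (2 * i%:Z + l) (gaps r J) in
  [/\ qbinomv q (m + ratv (gaps r J)) (ratv (gaps r J)) =
       \prod_(k < r) (let x := \sum_(k.+1 <= t < N) (2 * J t - L%:Z) in
         (0 <= x)%R%:R * gbin q (x + (J k - J k.+1)) (J k - J k.+1)),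
      qbinom q ((L%:R + l%:~R + firstv m) / 2) (i%:R + l%:~R) =
        (0 <= L%:Z - J 0%N)%R%:R * gbin q (i%:Z + l + L%:Z - J 0%N) (i%:Z + l) &
      qbinom q ((L%:R - l%:~R + firstv m) / 2) i%:R =
        (0 <= L%:Z - J 0%N)%R%:R * gbin q (i%:Z + L%:Z - J 0%N) i%:Z].
  move=> Js m; have mE : m = mvec (2 * (\sum_(t < N) J t) - (N * L)%:Z) (gaps r J).
    by rewrite -kE.
  have fE : firstv m = 2 * (i%:R - (J 0%N)%:~R) + l%:~R + L%:R.
    rewrite mE firstv_mvec_gaps.
    have -> : \sum_(1 <= t < N) (2 * J t - L%:Z) = 2 * (i%:Z - J 0%N) + l + L%:Z.
      have := congr1 (fun v => 2 * v) Js; rewrite -(big_mkord xpredT J) big_nat_recl //.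
      rewrite sumrB sumr_const_nat -mulr_sumr big_add1 /= lE mulSn => h.
      have -> : L%:Z *+ (N - 1) = (r * L)%N%:Z by rewrite subn1 -mulr_natl natz PoszM.
      by move: h; set A := \sum_(0 <= k < r) _; lia.
    by rewrite !intrD intrM intrB.
  split.
  - rewrite /qbinomv; apply: eq_bigr => k _; rewrite mxE mE mvec_gaps !mxE -intrD.
    by rewrite qbinomE // addrK.
  - have -> : (L%:R + l%:~R + firstv m) / 2 = (i%:Z + l + L%:Z - J 0%N)%:~R.
      by rewrite fE intrB !intrD -!pmulrn; field; rewrite ?(natr1, nat1r).
    have -> : i%:R + l%:~R = (i%:Z + l)%:~R :> rat by rewrite intrD.
    by rewrite qbinomE //; congr ((0 <= _)%R%:R * _); ring.
  - have -> : (L%:R - l%:~R + firstv m) / 2 = (i%:Z + L%:Z - J 0%N)%:~R.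
      by rewrite fE intrB !intrD -!pmulrn; field; rewrite ?(natr1, nat1r).
    rewrite -[i%:R]/(i%:Z%:~R).
    by rewrite qbinomE //; congr ((0 <= _)%R%:R * _); ring.
rewrite (@fsum_gaps _ r L (s + i)%N%:Z); last first.
  move=> J Js; cbv beta zeta; have [-> -> ->] := termE J Js.
  rewrite !mulf_eq0 !negb_or -!andbA => /and5P[_ /prodf_neq0 h1 h2 _ _].
  have h k : (k < r)%N -> (0 <= J k - J k.+1) &&
      (0 <= \sum_(k.+1 <= t < N) (2 * J t - L%:Z)).
    move=> kr; have := h1 (Ordinal kr) isT; rewrite mulf_eq0 negb_or.
    by rewrite boolr_neq0 => /andP[-> /gbin_neq0[-> _]].
  apply: partition_bounds => [k /h/andP[]||]; first by rewrite subr_ge0.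
    (* j_N >= 0, because j_N = s + i for N = 1 and m_(N-1) = 2 j_N - L >= 0
       otherwise. *)
    case: (posnP r) => [r0|r0].
      move: Js; rewrite big_ord_recr /= big1 => [|k _]; first by rewrite add0r => ->.
      by have := ltn_ord k; lia.
    have := h r.-1; rewrite prednK // leqnn => /(_ isT)/andP[_].
    by rewrite big_nat1; lia.
  by move: h2; rewrite boolr_neq0 subr_ge0.
pose W (J : seq nat) := weight_prod q L J *
  (gbin q (i%:Z + l + L%:Z - part J 0) (i%:Z + l) * gbin q (i%:Z + L%:Z - part J 0) i%:Z *
   fermionic_steps q L (head 0%N J) (behead J)).
transitivity (z ^ ((N * L * s)%:Z - (s * s)%:Z) *
   \sum_(t : N.-tuple 'I_L.+1 | (\sum_(j <- nats t) j)%N%:Z == (s + i)%N%:Z) W (nats t)).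
  rewrite !mulr_sumr; apply: eq_bigr => t; case/tupleP: t => j t /eqP St.
  set J := nats _ in St *.
  have sJ : size J = N by rewrite size_nats.
  have Js : \sum_(k < N) part J k = (s + i)%N%:Z by rewrite -St Posz_sum (sum_part _ id) sJ.
  cbv beta zeta; have [-> -> ->] := termE _ Js.
  have SJ : (\sum_(i <- J) i)%N = (s + i)%N by lia.
  rewrite qpow_Cform_gaps // SJ.
  rewrite (_ : qpow N z _ = z ^ (i%:Z * (i%:Z + l))); last first.
    by apply: qpowE; rewrite mulrC mulfVK // intrM intrD.
  have -> : (0 <= L%:Z - part J 0) by rewrite /part /=; have := ltn_ord j; lia.
  (* The power q^(i(i+l)/N) compensates for S = s + i in place of S = s. *)
  rewrite !mul1r /W (_ : (N * L * s)%:Z - (s * s)%:Z = i%:Z * (i%:Z + l) +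
    ((N * L * (s + i))%N%:Z - ((s + i) * (s + i))%N%:Z)); last first.
    by rewrite lE !PoszM PoszD; ring.
  rewrite [in RHS]expfzDr // [behead _]/= [head _ _]/= fermionic_steps_prod size_nats.
  rewrite -![part (val j :: nats t)]/(part J).
  rewrite [X in _ = _ * (_ * (_ * X))](eq_bigr (fun k : 'I_r =>
     let x := \sum_(k.+1 <= t < N) (2 * part J t - L%:Z) in
     (0 <= x)%R%:R * gbin q (x + (part J k - part J k.+1)) (part J k - part J k.+1))).
    by cbv beta zeta; ring.
  by move=> k _; cbv beta zeta; rewrite gbin_swap.
congr (_ * _); rewrite big_mkcond (sum_tupleS r (fun t =>
   if (\sum_(j <- nats t) j)%N%:Z == (s + i)%N%:Z then W (nats t) else 0)) /fermionic_term.
apply: eq_bigr => j _; have jL : (j <= L)%N := ltn_ord j.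
rewrite fermionic_chainE //.
rewrite mulr_sumr [RHS]big_mkcond; apply: eq_bigr => t _ /=; rewrite big_cons.
have -> : (2 * i%:Z + l + L%:Z - 2 * j%:Z + (r * L)%:Z == 2 * (\sum_(i <- nats t) i)%N%:Z) =
   ((j + \sum_(i <- nats t) i)%N%:Z == (s + i)%N%:Z).
  by rewrite lE mulSn; lia.
by case: ifP => // _; rewrite /W /=; ring.
Qed.

Lemma fermionic_term_total :
  \sum_(i \in [set: nat]) fermionic_term i = multinomial_chain q L N L l.
Proof.
pose K := `|(N.+2 * L)%:Z - l|.+1.
rewrite -(@fermionic_sum_multinomial _ _ q_nroot q_neq0 _ N K) //; last by rewrite /K; lia.
have supp (j : nat) x : (j <= L)%N -> fermionic_chain q L N j x != 0 ->
    x <= (N.+1 * L)%:Z by move=> jL /(fermionic_chain_supp q_neq0 jL)/andP[].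
rewrite (@fsbigE _ _ _ _ _ (iota 0 K)) ?iota_uniq //; last first.
  move=> i _; rewrite mem_iota add0n leq0n /= -leqNgt => Ki.
  rewrite /fermionic_term big1 // => j _; apply/eqP; apply: contraTT Ki; rewrite mulf_eq0 negb_or.
  have jL : (j <= L)%N := ltn_ord j; case/andP=> _ /(supp _ _ jL).
  by rewrite /K !mulSn; lia.
rewrite (eq_bigl xpredT) => [|i]; last by rewrite in_setT.
have -> : \sum_(i <- iota 0 K) fermionic_term i = \sum_(i < K) fermionic_term i.
  by rewrite -(big_mkord xpredT) /index_iota subn0.
rewrite /fermionic_term /fermionic_sum exchange_big [RHS]exchange_big; apply: eq_bigr => j _ /=.
pose f (i : int) := weight q L j%:Z *
  gbin q (i + l + L%:Z - j%:Z) (i + l) * gbin q (i + L%:Z - j%:Z) i *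
  fermionic_chain q L N j (2 * i + l + L%:Z - 2 * j%:Z).
rewrite (@sum_int_shift _ f K K (j%:Z - L%:Z)); last first.
  have jL : (j <= L)%N := ltn_ord j.
  move=> i; rewrite /f !mulf_eq0 !negb_or -!andbA.
  case/and4P=> _ _ /gbin_neq0[i0 _] /(supp _ _ jL).
  by rewrite /K !mulSn; lia.
apply: eq_bigr => B _; rewrite /f; congr (_ * gbin q _ _ * gbin q _ _ * _); try lia.
by congr (fermionic_chain q L N j _); lia.
Qed.

End Translation.

(* F is any field and z a chosen N-th root of q := z ^+ N, q not a root of
   unity; formal q is the case of F = {fraction {poly rat}} and z = 'X. *)
Theorem mainTheorem3 (F : fieldType) (N L : nat) (z : F) (l : int)
    (N_gt0 : (0 < N)%N) (z_neq0 : z != 0)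
    (q_nroot : forall k : nat, (0 < k)%N -> (z ^+ N) ^+ k != 1)
    (l_range : exists2 k : nat, (k <= N * L)%N & l = - (N * L)%:Z + 2 * k%:Z) :
  let q := z ^+ N in
  qmultinomial N z L (l%:~R / 2) =
  \sum_(i \in [set: nat])
    qpow N z (i%:R * (i%:R + l%:~R) / N%:R) *
    \sum_(n \in [set n : 'cV[int]_N.-1 |
                 L%:R / 2 + (2 * i%:R + l%:~R) / (2 * N%:R)
                 + firstv (Cinvv (ratv n)) \is a Num.int])
      let m := mvec (2 * i%:Z + l) n in
      qpow N z (Cform (ratv n)) * qbinomv q (m + ratv n) (ratv n)
      * qbinom q ((L%:R + l%:~R + firstv m) / 2) (i%:R + l%:~R)
      * qbinom q ((L%:R - l%:~R + firstv m) / 2) i%:R.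
Proof.
case: N N_gt0 q_nroot l_range => // r _ q_nroot [s _ lE] q.
rewrite (qmultinomialE z_neq0 q_nroot lE) -(fermionic_term_total z_neq0 q_nroot lE) mulr_fsumr.
by apply: eq_fsbigr => i _; rewrite -(fermionic_sumE z_neq0 q_nroot lE).
Qed.
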